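(* Let $(\mathcal{L}_1,\circ^1_\lambda,[\cdot_\lambda\cdot]^1)$ and $(\mathcal{L}_2,\circ^2_\lambda,[\cdot_\lambda\cdot]^2)$ be two transposed Poisson conformal algebras. Set $\mathcal{L}:=\mathcal{L}_1\otimes_{\mathbb{C}[\partial]}\mathcal{L}_2$, with $\mathbb{C}[\partial]$-module structure $\partial(a\otimes b):=(\partial a)\otimes b=a\otimes(\partial b)$ for $a\in\mathcal{L}_1$, $b\in\mathcal{L}_2$. Define a $\lambda$-product and a $\lambda$-bracket on $\mathcal{L}$ by $$(a_1\otimes a_2)\circ_\lambda(b_1\otimes b_2)=(a_1\circ^1_\lambda b_1)\otimes(a_2\circ^2_\lambda b_2),$$ $$[(a_1\otimes a_2)_\lambda(b_1\otimes b_2)]=[{a_1}_\lambda b_1]^1\otimes(a_2\circ^2_\lambda b_2)+(a_1\circ^1_\lambda b_1)\otimes[{a_2}_\lambda b_2]^2,$$ for all $a_1,b_1\in\mathcal{L}_1$, $a_2,b_2\in\mathcal{L}_2$. Then $(\mathcal{L},\circ_\lambda,[\cdot_\lambda\cdot])$ is a transposed Poisson conformal algebra.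
   Context: All vector spaces and linear maps are over $\mathbb{C}$. For a vector space $A$, $A[\lambda]$ denotes polynomials in $\lambda$ with coefficients in $A$. Tensor products of elements of $\mathcal{L}_1[\lambda]$ and $\mathcal{L}_2[\lambda]$ are taken by multiplying powers of $\lambda$, giving elements of $\mathcal{L}[\lambda]$. A conformal algebra $(A,\circ_\lambda)$ is a $\mathbb{C}[\partial]$-module $A$ with a $\mathbb{C}$-bilinear map $A\times A\to A[\lambda]$, $(a,b)\mapsto a\circ_\lambda b$, such that $(\partial a)\circ_\lambda b=-\lambda\, a\circ_\lambda b$ and $a\circ_\lambda(\partial b)=(\partial+\lambda)(a\circ_\lambda b)$. Convention: products are extended linearly to polynomials in formal variables. If $a\circ_\lambda b=\sum_n\lambda^n w_n$ and $\nu$ is a linear combination of formal variables, then $a\circ_{-\partial+\nu}b=\sum_n(-\partial+\nu)^n w_n$; the same convention applies to $[a_\lambda b]$. A commutative associative conformal algebra is a conformal algebra with $a\circ_\lambda(b\circ_\mu c)=(a\circ_\lambda b)\circ_{\lambda+\mu}c$ and $a\circ_\lambda b=b\circ_{-\partial-\lambda}a$ for all $a,b,c$. A Lie conformal algebra $(A,[\cdot_\lambda\cdot])$ is a conformal algebra (with product written $[a_\lambda b]$) such that $[a_\lambda b]=-[b_{-\lambda-\partial}a]$ and $[a_\lambda[b_\mu c]]=[[a_\lambda b]_{\lambda+\mu}c]+[b_\mu[a_\lambda c]]$ for all $a,b,c$. A transposed Poisson conformal algebra (TPCA) is a $\mathbb{C}[\partial]$-module $\mathcal{L}$ with $\mathbb{C}$-bilinear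 maps $\circ_\lambda,[\cdot_\lambda\cdot]$ from $\mathcal{L}\times\mathcal{L}$ to $\mathcal{L}[\lambda]$ such that $(\mathcal{L},\circ_\lambda)$ is a commutative associative conformal algebra, $(\mathcal{L},[\cdot_\lambda\cdot])$ is a Lie conformal algebra, and $2(a\circ_\lambda[b_\mu c])=[(a\circ_\lambda b)_{\lambda+\mu}c]+[b_\mu(a\circ_\lambda c)]$ for all $a,b,c\in\mathcal{L}$. *)

(* Defs.v *)
From HB Require Import structures.
From mathcomp Require Import all_boot all_order all_algebra.
From mathcomp Require Import finmap boolp reals complex monalg.

Set Implicit Arguments.
Unset Strict Implicit.
Unset Printing Implicit Defensive.

Import GRing.Theory.
Local Open Scope ring_scope.
Local Open Scope quotient_scope.

(** * Tensor product of modules over a commutative ring *)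

Section Tensor.
Context {R : comNzRingType} {M N : lmodType R}.

Local Notation pairs := (M * N)%type.

(* The submodule of the free R-module on M * N generated by the bilinearity
   relations. *)
Inductive tensor_rel : {malg R[pairs]} -> Prop :=
| tensor_rel0 : tensor_rel 0
| tensor_relP a x y : tensor_rel x -> tensor_rel y -> tensor_rel (a *: x + y)
| tensor_relDl m m' n :
    tensor_rel (<< (m + m', n) >> - << (m, n) >> - << (m', n) >>)
| tensor_relDr m n n' :
    tensor_rel (<< (m, n + n') >> - << (m, n) >> - << (m, n') >>)
| tensor_relZl a m n : tensor_rel (<< (a *: m, n) >> - a *: << (m, n) >>)
| tensor_relZr a m n : tensor_rel (<< (m, a *: n) >> - a *: << (m, n) >>).

Definition tensor_relb : {pred {malg R[pairs]}} := fun x => `[< tensor_rel x >].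

Lemma tensor_relbP x : reflect (tensor_rel x) (x \in tensor_relb).
Proof. exact: asboolP. Qed.

Fact tensor_rel_zmod_closed : zmod_closed tensor_relb.
Proof.
split=> [|x y /tensor_relbP hx /tensor_relbP hy]; apply/tensor_relbP.
  exact: tensor_rel0.
by rewrite addrC -scaleN1r; exact: tensor_relP.
Qed.
HB.instance Definition _ :=
  GRing.isZmodClosed.Build _ tensor_relb tensor_rel_zmod_closed.
End Tensor.

Arguments tensor_relb {R} M N.

Definition tensor (R : comNzRingType) (M N : lmodType R) : Type :=
  Quotient.quot (tensor_relb M N).

HB.instance Definition _ (R : comNzRingType) (M N : lmodType R) :=
  GRing.Zmodule.on (tensor M N).

Notation "M ⊗[ R ] N" := (@tensor R M N)
  (at level 40, R at level 200, left associativity, format "M  ⊗[ R ]  N")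
  : type_scope.

Section TensorTheory.
Context {R : comNzRingType} {M N : lmodType R}.

Local Notation pairs := (M * N)%type.
Local Notation tpi x := (\pi_(Quotient.quot (tensor_relb M N)) x : M ⊗[R] N).

Fact tensor_piP x y : tpi x = tpi y <-> tensor_rel (x - y).
Proof.
split=> [/eqP|h].
  by rewrite -Quotient.idealrBE => /tensor_relbP.
by apply/eqP; rewrite -Quotient.idealrBE; apply/tensor_relbP.
Qed.

Fact tensor_piD x y : tpi (x + y) = tpi x + tpi y.
Proof. exact: Quotient.pi_add. Qed.

Fact tensor_pi0 : tpi 0 = 0.
Proof. by apply: (addrI (tpi 0)); rewrite -tensor_piD !addr0. Qed.

Definition tensor_scale (a : R) (t : M ⊗[R] N) : M ⊗[R] N :=
  tpi (a *: repr (t : Quotient.quot (tensor_relb M N))).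

Fact tensor_piZ a x : tensor_scale a (tpi x) = tpi (a *: x).
Proof.
apply/tensor_piP; rewrite -scalerBr -[_ *: _]addr0.
by apply: tensor_relP tensor_rel0; apply/tensor_piP; rewrite reprK.
Qed.

Fact tensor_piK (t : M ⊗[R] N) : {x | t = tpi x}.
Proof.
by exists (repr (t : Quotient.quot (tensor_relb M N))); rewrite reprK.
Qed.

Fact tensor_scaleA a b t :
  tensor_scale a (tensor_scale b t) = tensor_scale (a * b) t.
Proof. by have [x ->] := tensor_piK t; rewrite !tensor_piZ scalerA. Qed.

Fact tensor_scale1 : left_id 1 tensor_scale.
Proof. by move=> t; have [x ->] := tensor_piK t; rewrite tensor_piZ scale1r. Qed.

Fact tensor_scaleDr : right_distributive tensor_scale +%R.
Proof.
move=> a t u; have [x ->] := tensor_piK t; have [y ->] := tensor_piK u.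
by rewrite -tensor_piD !tensor_piZ scalerDr tensor_piD.
Qed.

Fact tensor_scaleDl t : {morph tensor_scale^~ t : a b / a + b}.
Proof.
by move=> a b; have [x ->] := tensor_piK t; rewrite !tensor_piZ scalerDl tensor_piD.
Qed.

HB.instance Definition _ := GRing.Zmodule_isLmodule.Build R (M ⊗[R] N)
  tensor_scaleA tensor_scale1 tensor_scaleDr tensor_scaleDl.

Definition tens (m : M) (n : N) : M ⊗[R] N := tpi << (m, n) >>.

Lemma tensDl m m' n : tens (m + m') n = tens m n + tens m' n.
Proof.
by rewrite -tensor_piD; apply/tensor_piP; rewrite opprD addrA; exact: tensor_relDl.
Qed.

Lemma tensDr m n n' : tens m (n + n') = tens m n + tens m n'.
Proof.
by rewrite -tensor_piD; apply/tensor_piP; rewrite opprD addrA; exact: tensor_relDr.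
Qed.

Lemma tensZl a m n : a *: tens m n = tens (a *: m) n.
Proof.
by rewrite [LHS]tensor_piZ; apply/esym/tensor_piP; exact: tensor_relZl.
Qed.

Lemma tensZr a m n : a *: tens m n = tens m (a *: n).
Proof.
by rewrite [LHS]tensor_piZ; apply/esym/tensor_piP; exact: tensor_relZr.
Qed.

Lemma tensor_sum (t : M ⊗[R] N) :
  exists s : seq (M * N), t = \sum_(mn <- s) tens mn.1 mn.2.
Proof.
have [x ->] := tensor_piK t.
exists [seq (x@_mn *: mn.1, mn.2) | mn <- msupp x].
rewrite big_map /= [x in LHS]monalgE.
elim/big_rec2: _ => [|[m n] u v _ <-]; first by rewrite tensor_pi0.
rewrite tensor_piD -tensZl [X in _ = X + _]tensor_piZ; congr (tpi _ + _).
by apply/malgP => k; rewrite mcoeffZ !mcoeffU mulr_natr.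
Qed.

(* The universal property; balanced biadditive maps into an arbitrary abelian
   group suffice. *)
Lemma tensor_lift (Z : zmodType) (g : M -> N -> Z) :
    (forall m m' n, g (m + m') n = g m n + g m' n) ->
    (forall m n n', g m (n + n') = g m n + g m n') ->
    (forall a m n, g (a *: m) n = g m (a *: n)) ->
  exists f : {additive M ⊗[R] N -> Z}, forall m n, f (tens m n) = g m n.
Proof.
move=> gDl gDr gZ.
have g0 n : g 0 n = 0 by apply: (addrI (g 0 n)); rewrite -gDl !addr0.
pose G (x : {malg R[pairs]}) := \sum_(k <- msupp x) g (x@_k *: k.1) k.2.
have Gw (D : {fset pairs}) x : (msupp x `<=` D)%fset ->
    G x = \sum_(k <- D) g (x@_k *: k.1) k.2.
  move=> sxD; rewrite /G (big_fset_incl _ sxD) // => k _ kx.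
  by rewrite mcoeff_outdom // scale0r g0.
have GD x y : G (x + y) = G x + G y.
  rewrite (Gw (msupp x `|` msupp y)%fset) ?msuppD_le //.
  rewrite [G x](Gw (msupp x `|` msupp y)%fset) ?fsubsetUl //.
  rewrite [G y](Gw (msupp x `|` msupp y)%fset) ?fsubsetUr //.
  by rewrite -big_split; apply: eq_bigr => k _; rewrite mcoeffD scalerDl gDl.
have G0 : G 0 = 0 by apply: (addrI (G 0)); rewrite -GD !addr0.
have GN x : G (- x) = - G x.
  by apply: (addrI (G x)); rewrite -GD !subrr G0.
have GU a k : G << a *g k >> = g (a *: k.1) k.2.
  by rewrite (Gw _ _ msuppU_le) big_seq_fset1 mcoeffUU.
have ZU (a : R) k : a *: (<< k >> : {malg R[pairs]}) = << a *g k >>.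
  by apply/malgP => j; rewrite mcoeffZ !mcoeffU mulr_natr.
have Grel x : tensor_rel x -> forall b, G (b *: x) = 0.
  elim=> {x} [|a x y _ IHx _ IHy|m m' n|m n n'|a m n|a m n] b.
  - by rewrite scaler0.
  - by rewrite scalerDr scalerA GD IHx IHy addr0.
  - by rewrite !scalerBr !ZU !GD !GN !GU /= scalerDr gDl addrAC addrK subrr.
  - by rewrite !scalerBr !ZU !GD !GN !GU /= gDr addrAC addrK subrr.
  - by rewrite scalerBr scalerA !ZU GD GN !GU /= scalerA subrr.
  - by rewrite scalerBr scalerA !ZU GD GN !GU /= -gZ scalerA mulrC subrr.
pose f (t : M ⊗[R] N) := G (repr (t : Quotient.quot (tensor_relb M N))).
have fpi x : f (tpi x) = G x.
  apply/eqP; rewrite -subr_eq0 -GN -GD -[_ - _]scale1r Grel //.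
  by apply/tensor_piP; rewrite reprK.
have fB : {morph f : t u / t - u}.
  move=> t u; have [x ->] := tensor_piK t; have [y ->] := tensor_piK u.
  have piN z : tpi (- z) = - tpi z.
    by apply: (addrI (tpi z)); rewrite -tensor_piD !subrr tensor_pi0.
  by rewrite -piN -tensor_piD !fpi GD GN.
pose fA := GRing.isZmodMorphism.Build _ _ f fB.
pose F : {additive M ⊗[R] N -> Z} := HB.pack f fA.
by exists F => m n; rewrite [LHS]fpi GU scale1r.
Qed.

End TensorTheory.

Notation "x ⊗ y" := (tens x y) (at level 40, left associativity) : ring_scope.

(** * Polynomials in formal variables with coefficients in a module *)

(* Finitely supported maps from exponents [T] to [A]. *)
Definition fpoly (T : choiceType) (A : zmodType) : Type := {malg A[T]}.

HB.instance Definition _ T A := GRing.Zmodule.on (fpoly T A).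

Notation poly1 := (fpoly nat). (* A[λ] *)
Notation poly2 := (fpoly (nat * nat)%type). (* A[λ,μ] *)

Section FormalPolynomials.
Context {R : nzRingType} {T : choiceType} {A : lmodType R}.
Implicit Types (p q : fpoly T A).

Definition fpoly_scale (a : R) p : fpoly T A :=
  [malg k in msupp p => a *: p@_k].

Lemma fpoly_scaleE a p k : (fpoly_scale a p)@_k = a *: p@_k.
Proof. by rewrite mcoeffE; case: msuppP; rewrite // scaler0. Qed.

Fact fpoly_scaleA a b p :
  fpoly_scale a (fpoly_scale b p) = fpoly_scale (a * b) p.
Proof. by apply/malgP => k; rewrite !fpoly_scaleE scalerA. Qed.

Fact fpoly_scale1 : left_id 1 fpoly_scale.
Proof. by move=> p; apply/malgP => k; rewrite fpoly_scaleE scale1r. Qed.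

Fact fpoly_scaleDr : right_distributive fpoly_scale +%R.
Proof.
by move=> a p q; apply/malgP => k; rewrite !(fpoly_scaleE, mcoeffD) scalerDr.
Qed.

Fact fpoly_scaleDl p : {morph fpoly_scale^~ p : a b / a + b}.
Proof.
by move=> a b; apply/malgP => k; rewrite !(fpoly_scaleE, mcoeffD) scalerDl.
Qed.

HB.instance Definition _ := GRing.Zmodule_isLmodule.Build R (fpoly T A)
  fpoly_scaleA fpoly_scale1 fpoly_scaleDr fpoly_scaleDl.
End FormalPolynomials.

(* Applies [s] to every exponent; used below for multiplication by a variable. *)
Definition fpoly_shift (T : choiceType) (A : zmodType) (s : T -> T)
    (p : fpoly T A) : fpoly T A :=
  \sum_(k <- msupp p) << p@_k *g s k >>.

(* Multiplication by λ on A[λ]. *)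
Definition mulX (A : zmodType) : poly1 A -> poly1 A := fpoly_shift succn.

(* Multiplication by λ, by μ and by λ^i μ^j on A[λ,μ]. *)
Definition lam (A : zmodType) : poly2 A -> poly2 A :=
  fpoly_shift (fun k => (k.1.+1, k.2)).
Definition mu (A : zmodType) : poly2 A -> poly2 A :=
  fpoly_shift (fun k => (k.1, k.2.+1)).
Definition mulmon (A : zmodType) (k : nat * nat) (p : poly2 A) : poly2 A :=
  iter k.1 (@lam A) (iter k.2 (@mu A) p).

Definition cst (A : zmodType) (a : A) : poly2 A := << a *g (0%N, 0%N) >>.

Arguments mulX {A} p.
Arguments lam {A} p.
Arguments mu {A} p.

(** * Conformal algebras *)

(* A K[∂]-module is a [{poly K}]-module, with ∂ acting as ['X]. On A[λ] and
   A[λ,μ], ∂ acts on the coefficients. *)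

Section Conformal.
Context {K : fieldType} {A : lmodType {poly K}}.
Implicit Types (prod circ brk : A -> A -> poly1 A) (a b c : A).

(* For w = \sum_n λ^n w_n in A[λ] and an operator φ on A[λ,μ], such as λ+μ or
   -∂-λ, the element \sum_n φ^n w_n. *)
Definition feval (phi : poly2 A -> poly2 A) (w : poly1 A) : poly2 A :=
  \sum_(n <- msupp w) iter n phi (cst w@_n).

(* The product at φ, extended K[λ,μ]-linearly to polynomials F and G. *)
Definition xprod prod (phi : poly2 A -> poly2 A) (F G : poly2 A) : poly2 A :=
  \sum_(k <- msupp F) \sum_(l <- msupp G)
    mulmon k (mulmon l (feval phi (prod F@_k G@_l))).

Definition lam_mu : poly2 A -> poly2 A := fun p => lam p + mu p.

Definition neg_d_lam : poly2 A -> poly2 A := fun p => - ('X *: p) - lam p.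

(* The scalars K act through the constant polynomials. *)
Definition Kbilinear prod :=
  (forall (k : K) a a' b,
     prod (k%:P *: a + a') b = k%:P *: prod a b + prod a' b) /\
  (forall (k : K) a b b',
     prod a (k%:P *: b + b') = k%:P *: prod a b + prod a b').

Definition conformal prod :=
  [/\ Kbilinear prod,
      forall a b, prod ('X *: a) b = - mulX (prod a b) &
      forall a b, prod a ('X *: b) = 'X *: prod a b + mulX (prod a b)].

(* A[λ] is embedded in A[λ,μ], where all identities are stated. *)
Definition comm_assoc_conformal circ :=
  [/\ conformal circ,
      forall a b c,
        xprod circ lam (cst a) (xprod circ mu (cst b) (cst c)) =
        xprod circ lam_mu (xprod circ lam (cst a) (cst b)) (cst c) &
      forall a b,
        xprod circ lam (cst a) (cst b) = xprod circ neg_d_lam (cst b) (cst a)].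

Definition Lie_conformal brk :=
  [/\ conformal brk,
      forall a b,
        xprod brk lam (cst a) (cst b) = - xprod brk neg_d_lam (cst b) (cst a) &
      forall a b c,
        xprod brk lam (cst a) (xprod brk mu (cst b) (cst c)) =
        xprod brk lam_mu (xprod brk lam (cst a) (cst b)) (cst c) +
        xprod brk mu (cst b) (xprod brk lam (cst a) (cst c))].

Definition TPCA circ brk :=
  [/\ comm_assoc_conformal circ, Lie_conformal brk &
      forall a b c,
        xprod circ lam (cst a) (xprod brk mu (cst b) (cst c)) *+ 2 =
        xprod brk lam_mu (xprod circ lam (cst a) (cst b)) (cst c) +
        xprod brk mu (cst b) (xprod circ lam (cst a) (cst c))].
End Conformal.

(* The tensor product of w in L1[λ] and v in L2[λ], in (L1 ⊗ L2)[λ]. *)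
Definition tens_poly (R : comNzRingType) (L1 L2 : lmodType R)
    (w : poly1 L1) (v : poly1 L2) : poly1 (L1 ⊗[R] L2) :=
  \sum_(m <- msupp w) \sum_(n <- msupp v) << w@_m ⊗ v@_n *g (m + n)%N >>.

(* Main.v *)
Require Import Defs.
From HB Require Import structures.
From mathcomp Require Import all_boot all_order all_algebra.
From mathcomp Require Import finmap boolp reals complex monalg.

Import GRing.Theory.
Local Open Scope ring_scope.
Local Open Scope complex_scope.

Set Implicit Arguments.
Unset Strict Implicit.
Unset Printing Implicit Defensive.

(** The tensor product of two transposed Poisson conformal algebras.

The definition on pure tensors passes to [L1 ⊗ L2] because sesquilinearity
makes the formulas balanced over the polynomials in [∂]: moving [∂] from one
factor to the other multiplies both sides by the same expression in [∂] and
[λ] ([tensor_product_exists]). An additive map on a tensor product is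
determined by its values on pure tensors, which gives uniqueness and also
reduces every axiom to pure tensors.

On pure tensors an iterated product of the tensor products is the tensor
product, over the polynomials in [λ] and [μ], of the iterated products of the
factors ([xprod_tens]); this holds for products taken at any value such as
[λ+μ] or [-∂-λ], since [∂] is a scalar of the tensor product and acts through
either factor. Commutativity, associativity and skew-symmetry then come
directly from the factors. For the other two axioms write, in either factor,

  P_a = a ∘_λ [b _μ c],       Q_a = [a _λ (b ∘_μ c)],
  P_b = b ∘_μ [a _λ c],       Q_b = [b _μ (a ∘_λ c)],
  P_c = [a _λ b] ∘_{λ+μ} c,   Q_c = [(a ∘_λ b) _{λ+μ} c].

The compatibility axiom, with [λ] and [μ] exchanged or with [λ] replaced by
[-∂-λ-μ], becomes (lemmas [TPCA_compat], [TPCA_compat_swap],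
[TPCA_compat_bracket])

  2 P_a = Q_c + Q_b,   2 P_b = Q_c + Q_a,   2 P_c = Q_a - Q_b.

Each side of the Jacobi identity of the tensor product consists of terms with a
double bracket in one factor and a double product in the other, which match by
the Jacobi identity and by associativity of the factors, and of mixed terms
[P ⊗ Q] and [Q ⊗ P]. After doubling, the mixed terms are expressed by the [Q]
alone and cancel ([cross_terms]); this is where [2] has to be invertible. The
compatibility axiom of the tensor product is the sum of the relations
[2 P_a = Q_c + Q_b] of both factors, each tensored with an associative triple
product of the other ([compat_terms]).

Substitutions such as [λ := -∂-λ-μ] are delicate because [∂] does not commute
with taking products. They are organised by formal linear expressions in [∂],
[λ] and [μ] (the type [symbol]): an expression that acts on an argument of a
product at [s] acts on the result after [∂] is replaced by [-s] (left argument)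
or [∂+s] (right argument). *)

(** * Additive maps *)

Definition additive_map (U V : zmodType) (f : U -> V) := {morph f : x y / x + y}.

Definition biadditive (U V W : zmodType) (f : U -> V -> W) :=
  (forall y, additive_map (f^~ y)) /\ (forall x, additive_map (f x)).

Lemma biadditive_add (U V W : zmodType) (f g : U -> V -> W) :
  biadditive f -> biadditive g -> biadditive (fun x y => f x y + g x y).
Proof.
move=> [fl fr] [gl gr]; split=> ? x y.
  by rewrite (fl _ _ _) (gl _ _ _) addrACA.
by rewrite (fr _ _ _) (gr _ _ _) addrACA.
Qed.

Section AdditiveMaps.
Context {U V : zmodType} {f : U -> V}.
Hypothesis fD : additive_map f.

Lemma additive_map0 : f 0 = 0.
Proof. by apply: (addrI (f 0)); rewrite -fD !addr0. Qed.

Lemma additive_mapN x : f (- x) = - f x.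
Proof. by apply: (addrI (f x)); rewrite -fD !subrr additive_map0. Qed.

Lemma additive_map_sum (I : Type) (r : seq I) (F : I -> U) :
  f (\sum_(i <- r) F i) = \sum_(i <- r) f (F i).
Proof.
by elim: r => [|i r IH]; rewrite ?(big_nil, big_cons) ?additive_map0 // fD IH.
Qed.
End AdditiveMaps.

(** * Polynomials in formal variables *)

Section Extend.
Context {T : choiceType} {A B : zmodType}.

Section Sum.
Variable h : T -> A -> B.
Hypothesis hD : forall k, additive_map (h k).

Let hw (D : {fset T}) (p : fpoly T A) : (msupp p `<=` D)%fset ->
  \sum_(k <- msupp p) h k p@_k = \sum_(k <- D) h k p@_k.
Proof.
move=> sD; rewrite (big_fset_incl _ sD) // => k _ kx.
by rewrite mcoeff_outdom // (additive_map0 (hD k)).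
Qed.

(** Operations on polynomials are sums over a support that varies with the
argument; enlarging both supports to a common one shows that they are
additive. *)
Lemma msupp_sumD :
  additive_map (fun p : fpoly T A => \sum_(k <- msupp p) h k p@_k).
Proof.
move=> p q; rewrite (@hw (msupp p `|` msupp q)%fset) ?msuppD_le //.
rewrite [X in _ = X + _](@hw (msupp p `|` msupp q)%fset) ?fsubsetUl //.
rewrite [X in _ = _ + X](@hw (msupp p `|` msupp q)%fset) ?fsubsetUr //.
by rewrite -big_split; apply: eq_bigr => k _; rewrite mcoeffD hD.
Qed.

Lemma msupp_sumU a k :
  \sum_(l <- msupp (<< a *g k >> : fpoly T A)) h l << a *g k >>@_l = h k a.
Proof. by rewrite (hw (msuppU_le (k := k))) big_seq_fset1 mcoeffUU. Qed.
End Sum.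

Lemma fpoly_ext (f g : fpoly T A -> B) : additive_map f -> additive_map g ->
  (forall a k, f << a *g k >> = g << a *g k >>) -> f =1 g.
Proof.
move=> fD gD fg p; rewrite [p]monalgE (additive_map_sum fD) (additive_map_sum gD).
by apply: eq_bigr => k _; apply: fg.
Qed.

Lemma monomialD k : additive_map (fun a => << a *g k >> : fpoly T A).
Proof. by move=> a b; rewrite monalgUD. Qed.
End Extend.

Section DoubleSum.
Context {T U : choiceType} {A B C : zmodType}.

Lemma fpoly_ext2 (f g : fpoly T A -> fpoly U B -> C) :
  biadditive f -> biadditive g ->
  (forall a b k l, f << a *g k >> << b *g l >> = g << a *g k >> << b *g l >>) ->
  forall F G, f F G = g F G.
Proof.
move=> [fl fr] [gl gr] fg F G.
apply: (fpoly_ext (f := f^~ G) (g := g^~ G)) => // a k.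
by apply: (fpoly_ext (f := f _) (g := g _)).
Qed.

Variable h : T -> U -> A -> B -> C.
Hypothesis hB : forall k l, biadditive (h k l).

Let inD k a : additive_map
  (fun G : fpoly U B => \sum_(l <- msupp G) h k l a G@_l).
Proof. by apply: (msupp_sumD (h := fun l b => h k l a b)) => l; apply: (hB k l).2. Qed.

Let outD (G : fpoly U B) k : additive_map
  (fun a => \sum_(l <- msupp G) h k l a G@_l).
Proof.
by move=> x y; rewrite -big_split; apply: eq_bigr => l _; apply: (hB k l).1.
Qed.

Lemma msupp_sum2D : biadditive (fun (F : fpoly T A) (G : fpoly U B) =>
  \sum_(k <- msupp F) \sum_(l <- msupp G) h k l F@_k G@_l).
Proof.
split=> [G|F]; first exact: (msupp_sumD (outD G)).
by move=> x y; rewrite -big_split; apply: eq_bigr => k _; apply: inD.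
Qed.

Lemma msupp_sum2U a b k l :
  \sum_(i <- msupp (<< a *g k >> : fpoly T A))
    \sum_(j <- msupp (<< b *g l >> : fpoly U B))
      h i j << a *g k >>@_i << b *g l >>@_j = h k l a b.
Proof.
rewrite (msupp_sumU (outD _)).
by apply: (msupp_sumU (h := fun l b => h k l a b)) => j; apply: (hB k j).2.
Qed.
End DoubleSum.

Section Shift.
Context {T : choiceType} {A : zmodType}.
Variable s : T -> T.

Lemma fpoly_shiftD : additive_map (@fpoly_shift T A s).
Proof. by apply: (msupp_sumD (h := fun k a => << a *g s k >>)) => k; apply: monomialD. Qed.

Lemma fpoly_shiftU a k : @fpoly_shift T A s << a *g k >> = << a *g s k >>.
Proof.
by apply: (msupp_sumU (h := fun k a => << a *g s k >>)) => l; apply: monomialD.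
Qed.
End Shift.

Definition cst1 (A : zmodType) (a : A) : poly1 A := << a *g 0%N >>.

Section Formal.
Context {A : zmodType}.

Lemma cstD : additive_map (@cst A).
Proof. exact: monomialD. Qed.

Lemma monomial1E a n : << a *g n >> = iter n mulX (cst1 a : poly1 A).
Proof. by elim: n => //= n <-; rewrite /mulX fpoly_shiftU. Qed.

Lemma monomial2E a k : << a *g k >> = mulmon k (cst a : poly2 A).
Proof.
case: k => i j; rewrite /mulmon /=.
have -> : iter j mu (cst a : poly2 A) = << a *g (0%N, j) >>.
  by elim: j => //= j ->; rewrite /mu fpoly_shiftU.
by elim: i => //= i <-; rewrite /lam fpoly_shiftU.
Qed.

Lemma lamD : additive_map (@lam A). Proof. exact: fpoly_shiftD. Qed.
Lemma muD : additive_map (@mu A). Proof. exact: fpoly_shiftD. Qed.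
Lemma mulXD : additive_map (@mulX A). Proof. exact: fpoly_shiftD. Qed.

Lemma lam_muC (p : poly2 A) : lam (mu p) = mu (lam p).
Proof.
apply: (fpoly_ext (f := fun p => lam (mu p)) (g := fun p => mu (lam p))).
- by move=> x y; rewrite muD lamD.
- by move=> x y; rewrite lamD muD.
- by move=> a k; rewrite /lam /mu !fpoly_shiftU.
Qed.

(** [A[λ]] is generated by its constants under multiplication by [λ]; the
operator [phi] by which both maps translate that multiplication is arbitrary,
as the values of interest are evaluations at some [φ] other than [λ]. *)
Lemma poly1_ext (B : zmodType) (phi : B -> B) (f g : poly1 A -> B) :
  additive_map f -> additive_map g ->
  (forall p, f (mulX p) = phi (f p)) -> (forall p, g (mulX p) = phi (g p)) ->
  (forall a, f (cst1 a) = g (cst1 a)) -> f =1 g.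
Proof.
move=> fD gD fX gX fg; apply: fpoly_ext => // a n; rewrite monomial1E.
by elim: n => //= n IH; rewrite fX gX IH.
Qed.
End Formal.

(** The property of being linear over the polynomials in [λ] and [μ] with
integer coefficients; [∂] is left out, as products do not commute with it. *)
Definition polylinear (A B : zmodType) (f : poly2 A -> poly2 B) :=
  [/\ additive_map f, forall p, f (lam p) = lam (f p) &
      forall p, f (mu p) = mu (f p)].

Lemma polylinear_comp (A B C : zmodType) (f : poly2 B -> poly2 C)
    (g : poly2 A -> poly2 B) :
  polylinear f -> polylinear g -> polylinear (fun p => f (g p)).
Proof.
case=> fD fl fm [gD gl gm]; split=> [x y|p|p].
- by rewrite gD fD.
- by rewrite gl fl.
- by rewrite gm fm.
Qed.

Lemma polylinear_ext (A B : zmodType) (f g : poly2 A -> poly2 B) :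
  polylinear f -> polylinear g -> (forall a, f (cst a) = g (cst a)) -> f =1 g.
Proof.
case=> fD fl fm [gD gl gm] fg; apply: fpoly_ext => // a [i j].
rewrite monomial2E /mulmon /=; elim: i => /= [|i IH]; last by rewrite fl gl IH.
by elim: j => //= j IH; rewrite fm gm IH.
Qed.

Section Scale.
Context {R : nzRingType} {T : choiceType} {A : lmodType R}.

Lemma fpoly_scaleU (c : R) (a : A) (k : T) :
  c *: (<< a *g k >> : fpoly T A) = << c *: a *g k >>.
Proof. by apply/malgP => l; rewrite fpoly_scaleE !mcoeffU scalerMnr. Qed.

Lemma fpoly_shiftZ s (c : R) (p : fpoly T A) :
  fpoly_shift s (c *: p) = c *: fpoly_shift s p.
Proof.
apply: (fpoly_ext (f := fun p => fpoly_shift s (c *: p))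
  (g := fun p => c *: fpoly_shift s p)).
- by move=> x y; rewrite scalerDr fpoly_shiftD.
- by move=> x y; rewrite fpoly_shiftD scalerDr.
- by move=> a k; rewrite fpoly_scaleU !fpoly_shiftU fpoly_scaleU.
Qed.
End Scale.

(** * Linear expressions in the formal variables *)

(** Formal integer combinations of [∂] ([Dee]), [λ] and [μ], at which products
are evaluated. The syntax is kept because the same expression acts on different
modules and because products alter it by substitution for [∂]. *)
Inductive symbol :=
  Dee | Lam | Mu | Add of symbol & symbol | Opp of symbol.

Fixpoint subst (d l m s : symbol) : symbol :=
  match s with
  | Dee => d
  | Lam => l
  | Mu => m
  | Add s t => Add (subst d l m s) (subst d l m t)
  | Opp s => Opp (subst d l m s)
  end.

Section Operators.
Context {K : fieldType}.
Implicit Types A B : lmodType {poly K}.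

Fixpoint op A (s : symbol) (p : poly2 A) : poly2 A :=
  match s with
  | Dee => 'X *: p
  | Lam => lam p
  | Mu => mu p
  | Add s t => op s p + op t p
  | Opp s => - op s p
  end.

Lemma opD A s : additive_map (@op A s).
Proof.
elim: s => /= [||| s IHs t IHt | s IH] x y.
- by rewrite scalerDr.
- exact: lamD.
- exact: muD.
- by rewrite IHs IHt addrACA.
- by rewrite IH opprD.
Qed.

(** The transformation rule behind products, tensor products and substitutions:
a map that turns the three variables into expressions turns every expression
into the substituted one. *)
Lemma op_intertwine A B (g : poly2 A -> poly2 B) d l m : additive_map g ->
  (forall p, g ('X *: p) = op d (g p)) ->
  (forall p, g (lam p) = op l (g p)) ->
  (forall p, g (mu p) = op m (g p)) ->
  forall s p, g (op s p) = op (subst d l m s) (g p).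
Proof.
move=> gD gd gl gm; elim=> //= [s IHs t IHt|s IH] p.
- by rewrite gD IHs IHt.
- by rewrite (additive_mapN gD) IH.
Qed.

Lemma subst_id s : subst Dee Lam Mu s = s.
Proof. by elim: s => //= [s -> t ->|s ->]. Qed.

Lemma op_equivariant A B (g : poly2 A -> poly2 B) : additive_map g ->
  (forall p, g ('X *: p) = 'X *: g p) ->
  (forall p, g (lam p) = lam (g p)) ->
  (forall p, g (mu p) = mu (g p)) ->
  forall s p, g (op s p) = op s (g p).
Proof.
move=> gD gd gl gm s p.
by rewrite (op_intertwine (d := Dee) (l := Lam) (m := Mu)) ?subst_id.
Qed.

Lemma op_scale A s c (p : poly2 A) : op s (c *: p) = c *: op s p.
Proof.
elim: s => /= [||| s -> t -> | s ->].
- by rewrite !scalerA mulrC.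
- exact: fpoly_shiftZ.
- exact: fpoly_shiftZ.
- by rewrite scalerDr.
- by rewrite scalerN.
Qed.

Lemma op_lam A s (p : poly2 A) : op s (lam p) = lam (op s p).
Proof.
apply/esym; apply: (op_equivariant (g := @lam A)) => //.
- exact: lamD.
- by move=> q; apply: fpoly_shiftZ.
- exact: lam_muC.
Qed.

Lemma op_mu A s (p : poly2 A) : op s (mu p) = mu (op s p).
Proof.
apply/esym; apply: (op_equivariant (g := @mu A)) => //.
- exact: muD.
- by move=> q; apply: fpoly_shiftZ.
- by move=> q; rewrite lam_muC.
Qed.

Lemma op_comm A s t (p : poly2 A) : op s (op t p) = op t (op s p).
Proof.
apply: (op_equivariant (g := @op A s)).
- exact: opD.
- exact: op_scale.
- exact: op_lam.
- exact: op_mu.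
Qed.

Lemma op_iter A s t n (p : poly2 A) : op s (iter n (op t) p) = iter n (op t) (op s p).
Proof. by elim: n => //= n <-; rewrite op_comm. Qed.

Lemma op_mulmon A s k (p : poly2 A) : op s (mulmon k p) = mulmon k (op s p).
Proof.
by rewrite /mulmon; rewrite (op_iter s Lam k.1) (op_iter s Mu k.2).
Qed.

Lemma mulmonD A k : additive_map (@mulmon A k).
Proof.
move=> x y; rewrite /mulmon.
have -> : iter k.2 mu (x + y) = iter k.2 mu x + iter k.2 mu y.
  by elim: k.2 => //= n ->; rewrite muD.
by elim: k.1 => //= n ->; rewrite lamD.
Qed.

Section Eval.
Context {A : lmodType {poly K}}.
Implicit Types (w : poly1 A) (s t : symbol).

Let iterD s n : additive_map (fun a : A => iter n (op s) (cst a)).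
Proof. by move=> x y; elim: n => [|n IH] /=; [rewrite cstD | rewrite IH opD]. Qed.

Lemma fevalD s : additive_map (feval (A := A) (op s)).
Proof. exact: (msupp_sumD (iterD s)). Qed.

Lemma feval_cst1 s (a : A) : feval (op s) (cst1 a) = cst a.
Proof. exact: (msupp_sumU (iterD s)). Qed.

Lemma feval_monomial s (a : A) n : feval (op s) << a *g n >> = iter n (op s) (cst a).
Proof. exact: (msupp_sumU (iterD s)). Qed.

(** Evaluation at [s] sends multiplication by [λ] to [s]; with [poly1_ext] this
characterises it. *)
Lemma feval_mulX s w : feval (op s) (mulX w) = op s (feval (op s) w).
Proof.
apply: (fpoly_ext (f := fun w => feval (op s) (mulX w))
  (g := fun w => op s (feval (op s) w))).
- by move=> x y; rewrite mulXD fevalD.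
- by move=> x y; rewrite fevalD opD.
- by move=> a n; rewrite /mulX fpoly_shiftU !feval_monomial.
Qed.

Lemma feval_scale s c w : feval (op s) (c *: w) = c *: feval (op s) w.
Proof.
apply: (poly1_ext (phi := op s) (f := fun w => feval (op s) (c *: w))
  (g := fun w => c *: feval (op s) w)).
- by move=> x y; rewrite scalerDr fevalD.
- by move=> x y; rewrite fevalD scalerDr.
- by move=> p; rewrite -feval_mulX; congr feval; rewrite /mulX fpoly_shiftZ.
- by move=> p; rewrite feval_mulX op_scale.
- by move=> a; rewrite fpoly_scaleU !feval_cst1 fpoly_scaleU.
Qed.
End Eval.
End Operators.

(** * Products at an arbitrary expression *)

Section Products.
Context {K : fieldType}.
Implicit Types (A : lmodType {poly K}) (s t : symbol).

Lemma Kbilinear_biadditive A (f : A -> A -> poly1 A) :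
  Kbilinear f -> biadditive f.
Proof.
case=> fl fr; split=> [b|a] x y; first by have := fl 1 x y b; rewrite !scale1r.
by have := fr 1 a x y; rewrite !scale1r.
Qed.

Lemma conformal_biadditive A (f : A -> A -> poly1 A) :
  conformal f -> biadditive f.
Proof. by case=> /Kbilinear_biadditive. Qed.

Lemma conformal_scale A (f : A -> A -> poly1 A) (fC : conformal f)
    (k : K) (a b : A) :
  (f (k%:P *: a) b = k%:P *: f a b) * (f a (k%:P *: b) = k%:P *: f a b).
Proof.
have [fl fr] := conformal_biadditive fC; case: fC => [[kl kr] _ _].
split; first by rewrite -[_ *: a]addr0 kl (additive_map0 (fl b)) addr0.
by rewrite -[_ *: b]addr0 kr (additive_map0 (fr a)) addr0.
Qed.

Lemma conformal_add A (f g : A -> A -> poly1 A) :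
  conformal f -> conformal g -> conformal (fun a b => f a b + g a b).
Proof.
case=> [[fl fr] fd fd'] [[gl gr] gd gd']; split=> [|a b|a b].
- split=> k a a' b; first by rewrite fl gl scalerDr addrACA.
  by rewrite fr gr scalerDr addrACA.
- by rewrite fd gd mulXD opprD.
- by rewrite fd' gd' mulXD scalerDr addrACA.
Qed.

Section Biadditive.
Context {A : lmodType {poly K}}.
Variable f : A -> A -> poly1 A.
Hypothesis fB : biadditive f.

Local Notation X s := (xprod f (op s)).

Let termD s (k l : nat * nat) :
  biadditive (fun a b => mulmon k (mulmon l (feval (op s) (f a b)))).
Proof.
by split=> ? x y; rewrite ?(fB.1 _ x y) ?(fB.2 _ x y) fevalD !mulmonD.
Qed.

Lemma xprodD s : biadditive (X s).
Proof. exact: msupp_sum2D (termD s). Qed.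

Lemma xprodDl s G : additive_map (fun F => X s F G).
Proof. exact: (xprodD s).1. Qed.

Lemma xprodDr s F : additive_map (X s F).
Proof. exact: (xprodD s).2. Qed.

Lemma xprod_monomial s a b k l :
  X s << a *g k >> << b *g l >> = mulmon k (mulmon l (feval (op s) (f a b))).
Proof. exact: msupp_sum2U (termD s) a b k l. Qed.

Lemma xprod_cst s a b : X s (cst a) (cst b) = feval (op s) (f a b).
Proof. exact: xprod_monomial. Qed.

Lemma xprod_polylinear_l s G : polylinear (fun F => X s F G).
Proof.
split=> [|F|F]; first exact: xprodDl.
- apply: (fpoly_ext2 (f := fun F G => X s (lam F) G) (g := fun F G => lam (X s F G))).
  + by split=> ? x y; rewrite ?lamD ?xprodDl ?xprodDr.
  + by split=> ? x y; rewrite ?xprodDl ?xprodDr lamD.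
  + by move=> a b k l; rewrite /lam fpoly_shiftU !xprod_monomial.
- apply: (fpoly_ext2 (f := fun F G => X s (mu F) G) (g := fun F G => mu (X s F G))).
  + by split=> ? x y; rewrite ?muD ?xprodDl ?xprodDr.
  + by split=> ? x y; rewrite ?xprodDl ?xprodDr muD.
  + move=> a b k l; rewrite {1}/mu fpoly_shiftU !xprod_monomial.
    by rewrite -[mu _]/(op Mu _) op_mulmon /mulmon /= -!(op_iter Mu Mu).
Qed.

Lemma xprod_polylinear_r s F : polylinear (X s F).
Proof.
split=> [|G|G]; first exact: xprodDr.
- apply: (fpoly_ext2 (f := fun F G => X s F (lam G)) (g := fun F G => lam (X s F G))).
  + by split=> ? x y; rewrite ?lamD ?xprodDl ?xprodDr.
  + by split=> ? x y; rewrite ?xprodDl ?xprodDr lamD.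
  + move=> a b k l; rewrite {1}/lam fpoly_shiftU !xprod_monomial.
    by rewrite -[lam (mulmon k _)]/(op Lam _) op_mulmon.
- apply: (fpoly_ext2 (f := fun F G => X s F (mu G)) (g := fun F G => mu (X s F G))).
  + by split=> ? x y; rewrite ?muD ?xprodDl ?xprodDr.
  + by split=> ? x y; rewrite ?xprodDl ?xprodDr muD.
  + move=> a b k l; rewrite {1}/mu fpoly_shiftU !xprod_monomial.
    rewrite -[mu (mulmon k _)]/(op Mu _) op_mulmon; congr mulmon.
    by rewrite op_mulmon /mulmon /= -!(op_iter Mu Mu).
Qed.
End Biadditive.

Lemma xprod_sum A (f g : A -> A -> poly1 A) s F G :
  xprod (fun a b => f a b + g a b) (op s) F G =
  xprod f (op s) F G + xprod g (op s) F G.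
Proof.
rewrite /xprod -big_split; apply: eq_bigr => k _.
rewrite -big_split; apply: eq_bigr => l _.
by rewrite fevalD !mulmonD.
Qed.

Lemma xprod_opp A (f : A -> A -> poly1 A) s F G :
  xprod (fun a b => - f a b) (op s) F G = - xprod f (op s) F G.
Proof.
rewrite /xprod -sumrN; apply: eq_bigr => k _.
rewrite -sumrN; apply: eq_bigr => l _.
by rewrite (additive_mapN (fevalD s)) !(additive_mapN (mulmonD _)).
Qed.

Section ConformalProduct.
Context {A : lmodType {poly K}}.
Variable f : A -> A -> poly1 A.
Hypothesis fC : conformal f.
Let fB := conformal_biadditive fC.

Local Notation X s := (xprod f (op s)).

Lemma xprod_d_l s F G : X s ('X *: F) G = - op s (X s F G).
Proof.
apply: (fpoly_ext2 (f := fun F G => X s ('X *: F) G)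
  (g := fun F G => - op s (X s F G))).
- by split=> ? x y; rewrite ?scalerDr ?(xprodDl fB) ?(xprodDr fB).
- by split=> ? x y; rewrite ?(xprodDl fB) ?(xprodDr fB) opD opprD.
- move=> a b k l; rewrite fpoly_scaleU !(xprod_monomial fB).
  case: fC => _ -> _; rewrite (additive_mapN (fevalD s)) feval_mulX.
  by rewrite !(additive_mapN (mulmonD _)) !op_mulmon.
Qed.

Lemma xprod_d_r s F G : X s F ('X *: G) = 'X *: X s F G + op s (X s F G).
Proof.
apply: (fpoly_ext2 (f := fun F G => X s F ('X *: G))
  (g := fun F G => op (Add Dee s) (X s F G))).
- by split=> ? x y; rewrite ?scalerDr ?(xprodDl fB) ?(xprodDr fB).
- by split=> ? x y; rewrite ?(xprodDl fB) ?(xprodDr fB) opD.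
- move=> a b k l; rewrite fpoly_scaleU !(xprod_monomial fB).
  case: fC => _ _ ->; rewrite fevalD feval_mulX feval_scale.
  by rewrite -[_ + _]/(op (Add Dee s) _) !op_mulmon.
Qed.

(** By sesquilinearity [∂] acts on the left argument of a product at [s] as
[-s], while [λ] and [μ] are scalars. *)
Lemma xprod_op_l s t F G :
  X s (op t F) G = op (subst (Opp s) Lam Mu t) (X s F G).
Proof.
have [D l m] := xprod_polylinear_l fB s G.
by apply: (op_intertwine (g := fun F => X s F G)) => // p; apply: xprod_d_l.
Qed.

(** On the right argument [∂] acts as [∂+s]. *)
Lemma xprod_op_r s t F G :
  X s F (op t G) = op (subst (Add Dee s) Lam Mu t) (X s F G).
Proof.
have [D l m] := xprod_polylinear_r fB s F.
by apply: (op_intertwine (g := X s F)) => // p; apply: xprod_d_r.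
Qed.
End ConformalProduct.

(** * Substitution for the formal variables *)

Section Substitution.
Context {A : lmodType {poly K}}.
Variables (phi psi : symbol).

(** Here [phi] and [psi] may involve [∂], which acts on the coefficients: in
[F(phi, psi)] every occurrence of [∂] is outside all products. *)
Definition substitute (F : poly2 A) : poly2 A :=
  \sum_(k <- msupp F) iter k.1 (op phi) (iter k.2 (op psi) (cst F@_k)).

Let iterD (k : nat * nat) : additive_map
  (fun a : A => iter k.1 (op phi) (iter k.2 (op psi) (cst a))).
Proof.
move=> x y; elim: k.1 => [|i IH] /=; last by rewrite IH opD.
by elim: k.2 => [|j IH] /=; [rewrite cstD | rewrite IH opD].
Qed.

Lemma substituteD : additive_map substitute.
Proof. exact: (msupp_sumD iterD). Qed.

Lemma substitute_monomial a k :
  substitute << a *g k >> = iter k.1 (op phi) (iter k.2 (op psi) (cst a)).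
Proof. exact: (msupp_sumU iterD). Qed.

Lemma substitute_cst a : substitute (cst a) = cst a.
Proof. exact: substitute_monomial. Qed.

Lemma substitute_op s F :
  substitute (op s F) = op (subst Dee phi psi s) (substitute F).
Proof.
apply: op_intertwine => [|p|p|p]; first exact: substituteD.
- apply: (fpoly_ext (f := fun p => substitute ('X *: p))
    (g := fun p => op Dee (substitute p))).
  + by move=> x y; rewrite scalerDr substituteD.
  + by move=> x y; rewrite substituteD opD.
  + move=> a k; rewrite fpoly_scaleU !substitute_monomial !op_iter.
    by rewrite /= fpoly_scaleU.
- apply: (fpoly_ext (f := fun p => substitute (lam p))
    (g := fun p => op phi (substitute p))).
  + by move=> x y; rewrite lamD substituteD.
  + by move=> x y; rewrite substituteD opD.
  + by move=> a k; rewrite /lam fpoly_shiftU !substitute_monomial.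
- apply: (fpoly_ext (f := fun p => substitute (mu p))
    (g := fun p => op psi (substitute p))).
  + by move=> x y; rewrite muD substituteD.
  + by move=> x y; rewrite substituteD opD.
  + by move=> a k; rewrite /mu fpoly_shiftU !substitute_monomial op_iter.
Qed.

Lemma substitute_feval s w :
  substitute (feval (op s) w) = feval (op (subst Dee phi psi s)) w.
Proof.
apply: (poly1_ext (phi := op (subst Dee phi psi s))
  (f := fun w => substitute (feval (op s) w))).
- by move=> x y; rewrite fevalD substituteD.
- exact: fevalD.
- by move=> p; rewrite feval_mulX substitute_op.
- by move=> p; rewrite feval_mulX.
- by move=> a; rewrite !feval_cst1 substitute_cst.
Qed.

Section Product.
Variable f : A -> A -> poly1 A.
Hypothesis fC : conformal f.
Let fB := conformal_biadditive fC.

Local Notation X s := (xprod f (op s)).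
Local Notation sb := (subst Dee phi psi).

(** Substitution acts outside the outer product, whereas the evaluation point
[t] of the inner one is seen from outside through the rule of [xprod_op_r]. The
substituted nested product is therefore a nested product whose inner point is
any [t'] that has the right appearance from outside. *)
Lemma substitute_xprod_r s t t' a w :
  (forall F : poly2 A, op (sb (subst (Add Dee s) Lam Mu t)) F =
     op (subst (Add Dee (sb s)) Lam Mu t') F) ->
  substitute (X s (cst a) (feval (op t) w)) =
  X (sb s) (cst a) (feval (op t') w).
Proof.
move=> tt'; apply: (poly1_ext (phi := op (sb (subst (Add Dee s) Lam Mu t)))
  (f := fun w => substitute (X s (cst a) (feval (op t) w)))
  (g := fun w => X (sb s) (cst a) (feval (op t') w))).
- by move=> x y; rewrite fevalD (xprodDr fB) substituteD.
- by move=> x y; rewrite fevalD (xprodDr fB).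
- by move=> p; rewrite feval_mulX (xprod_op_r fC) substitute_op.
- by move=> p; rewrite feval_mulX (xprod_op_r fC) -tt'.
- by move=> b; rewrite !feval_cst1 !(xprod_cst fB) substitute_feval.
Qed.

(** The same with the inner product on the left, where the inner point is seen
through the rule of [xprod_op_l]. *)
Lemma substitute_xprod_l s t t' a w :
  (forall F : poly2 A, op (sb (subst (Opp s) Lam Mu t)) F =
     op (subst (Opp (sb s)) Lam Mu t') F) ->
  substitute (X s (feval (op t) w) (cst a)) =
  X (sb s) (feval (op t') w) (cst a).
Proof.
move=> tt'; apply: (poly1_ext (phi := op (sb (subst (Opp s) Lam Mu t)))
  (f := fun w => substitute (X s (feval (op t) w) (cst a)))
  (g := fun w => X (sb s) (feval (op t') w) (cst a))).
- by move=> x y; rewrite fevalD (xprodDl fB) substituteD.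
- by move=> x y; rewrite fevalD (xprodDl fB).
- by move=> p; rewrite feval_mulX (xprod_op_l fC) substitute_op.
- by move=> p; rewrite feval_mulX (xprod_op_l fC) -tt'.
- by move=> b; rewrite !feval_cst1 !(xprod_cst fB) substitute_feval.
Qed.

Section Nested.
Variable g : A -> A -> poly1 A.
Hypothesis gC : conformal g.

Lemma substitute_xprod_cst_r s t t' a b c :
  (forall F : poly2 A, op (sb (subst (Add Dee s) Lam Mu t)) F =
     op (subst (Add Dee (sb s)) Lam Mu t') F) ->
  substitute (X s (cst a) (xprod g (op t) (cst b) (cst c))) =
  X (sb s) (cst a) (xprod g (op t') (cst b) (cst c)).
Proof.
rewrite !(xprod_cst (conformal_biadditive gC)); exact: substitute_xprod_r.
Qed.

Lemma substitute_xprod_cst_l s t t' a b c :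
  (forall F : poly2 A, op (sb (subst (Opp s) Lam Mu t)) F =
     op (subst (Opp (sb s)) Lam Mu t') F) ->
  substitute (X s (xprod g (op t) (cst a) (cst b)) (cst c)) =
  X (sb s) (xprod g (op t') (cst a) (cst b)) (cst c).
Proof.
rewrite !(xprod_cst (conformal_biadditive gC)); exact: substitute_xprod_l.
Qed.
End Nested.
End Product.
End Substitution.

Lemma xprod_eq A (f : A -> A -> poly1 A) s s' :
  (forall F : poly2 A, op s F = op s' F) ->
  forall F G, xprod f (op s) F G = xprod f (op s') F G.
Proof. by move=> /funext ->. Qed.

End Products.

(** * Commutativity at an arbitrary expression *)

Section Swap.
Context {K : fieldType} {A : lmodType {poly K}}.
Variables f g : A -> A -> poly1 A.
Hypotheses (fB : biadditive f) (gB : biadditive g).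

(** [-∂-s], the value of the formal variable after the arguments of a product
at [s] are exchanged. *)
Definition mirror (s : symbol) := Add (Opp Dee) (Opp s).

(** A commutation rule at [λ] gives the rule at every [s] by substituting [s]
for [λ], and extends from constants to polynomials by linearity. Two products
[f] and [g] allow for a sign. *)
Lemma xprod_swap :
  (forall a b, xprod f (op Lam) (cst a) (cst b) =
     xprod g (op (mirror Lam)) (cst b) (cst a)) ->
  forall s F G, xprod f (op s) F G = xprod g (op (mirror s)) G F.
Proof.
move=> fg s.
have cc a b : xprod f (op s) (cst a) (cst b) = xprod g (op (mirror s)) (cst b) (cst a).
  have := congr1 (substitute s Mu) (fg a b).
  by rewrite !(xprod_cst fB) !(xprod_cst gB) !substitute_feval.
move=> F G; apply: (polylinear_ext (xprod_polylinear_l fB s G)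
  (xprod_polylinear_r gB (mirror s) G)) => a.
exact: (polylinear_ext (xprod_polylinear_r fB s _)
  (xprod_polylinear_l gB (mirror s) _)).
Qed.
End Swap.

(** * Identities in a transposed Poisson conformal algebra *)

Section Consequences.
Context {K : fieldType} {A : lmodType {poly K}}.
Variables circ brk : A -> A -> poly1 A.
Hypothesis HA : TPCA circ brk.
Implicit Types a b c : A.

Local Notation "F ∘_[ s ] G" := (xprod circ (op s) F G)
  (at level 40, s at level 0, format "F  ∘_[ s ]  G").
Local Notation "⟦ F , G ⟧_ s" := (xprod brk (op s) F G)
  (at level 0, s at level 0, F, G at level 200, format "⟦ F ,  G ⟧_ s").
Local Notation LamMu := (Add Lam Mu).

Lemma TPCA_circ_conformal : conformal circ. Proof. by case: HA => [[]]. Qed.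
Lemma TPCA_brk_conformal : conformal brk. Proof. by case: HA => _ []. Qed.
Let circC := TPCA_circ_conformal.
Let brkC := TPCA_brk_conformal.
Let circB := conformal_biadditive circC.
Let brkB := conformal_biadditive brkC.

Lemma TPCA_assoc a b c :
  cst a ∘_[Lam] (cst b ∘_[Mu] cst c) = (cst a ∘_[Lam] cst b) ∘_[LamMu] cst c.
Proof. by case: HA => [[_ + _] _ _]; apply. Qed.

Lemma TPCA_Jacobi a b c :
  ⟦cst a, ⟦cst b, cst c⟧_Mu⟧_Lam =
  ⟦⟦cst a, cst b⟧_Lam, cst c⟧_LamMu + ⟦cst b, ⟦cst a, cst c⟧_Lam⟧_Mu.
Proof. by case: HA => _ [_ _ +] _; apply. Qed.

Lemma TPCA_compat a b c :
  (cst a ∘_[Lam] ⟦cst b, cst c⟧_Mu) *+ 2 =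
  ⟦cst a ∘_[Lam] cst b, cst c⟧_LamMu + ⟦cst b, cst a ∘_[Lam] cst c⟧_Mu.
Proof. by case: HA => _ _; apply. Qed.

Lemma neg_d_lamE : neg_d_lam = @op K A (mirror Lam).
Proof. by []. Qed.

Lemma TPCA_comm s F G : F ∘_[s] G = G ∘_[(mirror s)] F.
Proof.
apply: (xprod_swap circB circB) => a b.
by rewrite -neg_d_lamE; case: HA => [[_ _ circK] _ _]; rewrite -circK.
Qed.

Lemma TPCA_skew s F G : ⟦F, G⟧_s = - ⟦G, F⟧_(mirror s).
Proof.
have oppB : biadditive (fun a b => - brk a b).
  by split=> ? x y; rewrite ?brkB.1 ?brkB.2 opprD.
rewrite -xprod_opp; apply: (xprod_swap brkB oppB) => a b; rewrite xprod_opp.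
by rewrite -neg_d_lamE; case: HA => _ [_ brkK _] _; rewrite -brkK.
Qed.

Lemma substitute_id (F : poly2 A) : substitute Lam Mu F = F.
Proof.
apply: (polylinear_ext (f := substitute Lam Mu) (g := id)) => [||a].
- split=> [|p|p]; first exact: substituteD.
  + by rewrite (substitute_op Lam Mu Lam).
  + by rewrite (substitute_op Lam Mu Mu).
- by split.
- exact: substitute_cst.
Qed.

(** Commutativity gives [b ∘_μ a = a ∘_{-∂-μ} b]. On the left of a product at
[λ+μ] the operator [∂] acts as [-λ-μ], so that [-∂-μ] becomes [λ]. *)
Lemma circ_swap_inner f (fC : conformal f) a b c :
  xprod f (op LamMu) (cst b ∘_[Mu] cst a) (cst c) =
  xprod f (op LamMu) (cst a ∘_[Lam] cst b) (cst c).
Proof.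
rewrite TPCA_comm -[LHS]substitute_id.
rewrite (substitute_xprod_cst_l fC circC (t' := Lam)); first by [].
by move=> F; rewrite /= opprK addrK.
Qed.

(** Associativity for [b], [a], [c] with [λ] and [μ] exchanged. *)
Lemma TPCA_assoc_swap a b c :
  cst b ∘_[Mu] (cst a ∘_[Lam] cst c) = (cst a ∘_[Lam] cst b) ∘_[LamMu] cst c.
Proof.
rewrite -(circ_swap_inner circC).
have := congr1 (substitute Mu Lam) (TPCA_assoc b a c).
rewrite (substitute_xprod_cst_r circC circC (t' := Lam)); last by [].
rewrite (substitute_xprod_cst_l circC circC (t' := Mu)); last by [].
move=> ->; apply: xprod_eq => F.
exact: addrC.
Qed.

Lemma substitute_double phi psi (F G H : poly2 A) : F *+ 2 = G + H ->
  substitute phi psi F *+ 2 = substitute phi psi G + substitute phi psi H.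
Proof. by move=> FGH; rewrite mulr2n -!substituteD -mulr2n FGH. Qed.

(** Compatibility for [b], [a], [c] with [λ] and [μ] exchanged. *)
Lemma TPCA_compat_swap a b c :
  (cst b ∘_[Mu] ⟦cst a, cst c⟧_Lam) *+ 2 =
  ⟦cst a ∘_[Lam] cst b, cst c⟧_LamMu + ⟦cst a, cst b ∘_[Mu] cst c⟧_Lam.
Proof.
have := substitute_double Mu Lam (TPCA_compat b a c).
rewrite (substitute_xprod_cst_r circC brkC (t' := Lam)); last by [].
rewrite (substitute_xprod_cst_l brkC circC (t' := Mu)); last by [].
rewrite (substitute_xprod_cst_r brkC circC (t' := Mu)); last by [].
have E : ⟦cst b ∘_[Mu] cst a, cst c⟧_(Add Mu Lam) =
    ⟦cst a ∘_[Lam] cst b, cst c⟧_LamMu.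
  rewrite -(circ_swap_inner brkC); apply: xprod_eq => F; exact: addrC.
by rewrite -E.
Qed.

(** Compatibility for [c], [a], [b], with [λ := -∂-λ-μ] and [μ := λ]; by
commutativity [c] can be moved to the right of each product. *)
Lemma TPCA_compat_bracket a b c :
  (⟦cst a, cst b⟧_Lam ∘_[LamMu] cst c) *+ 2 =
  ⟦cst a, cst b ∘_[Mu] cst c⟧_Lam - ⟦cst b, cst a ∘_[Lam] cst c⟧_Mu.
Proof.
rewrite TPCA_comm.
have := substitute_double (mirror LamMu) Lam (TPCA_compat c a b).
rewrite (substitute_xprod_cst_r circC brkC (t' := Lam)); last by [].
(* The outer point is [-∂-μ], so that [-∂-λ] is seen as [-∂-λ-μ]. *)
rewrite (substitute_xprod_cst_l brkC circC (t' := mirror Lam)); last first.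
  by move=> F; rewrite /= opprK addrK.
(* The outer point is [λ], so that [-∂-μ] is seen as [-(∂+λ)-μ]. *)
rewrite (substitute_xprod_cst_r brkC circC (t' := mirror Mu)); last first.
  by move=> F; rewrite /= !opprD addrA.
have E : ⟦cst c ∘_[(mirror Lam)] cst a, cst b⟧_(Add (mirror LamMu) Lam) =
    - ⟦cst b, cst a ∘_[Lam] cst c⟧_Mu.
  rewrite -TPCA_comm TPCA_skew; congr (- _); apply: xprod_eq => F.
  rewrite /= (addrC (lam F)) [- (mu F + _)]opprD [_ + (_ - lam F)]addrA subrK.
  by rewrite opprD !opprK addKr.
by rewrite -(TPCA_comm Mu) addrC -E.
Qed.
End Consequences.

(** * Tensor products of polynomials *)

Section TensorMaps.
Context {R : comNzRingType} {M N : lmodType R}.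

Lemma tensor_ext (Z : zmodType) (g h : M ⊗[R] N -> Z) :
  additive_map g -> additive_map h ->
  (forall m n, g (m ⊗ n) = h (m ⊗ n)) -> g =1 h.
Proof.
move=> gD hD gh t; have [s ->] := tensor_sum t.
rewrite (additive_map_sum gD) (additive_map_sum hD).
by apply: eq_bigr => k _; apply: gh.
Qed.

Lemma tensor_ext2 (Z : zmodType) (g h : M ⊗[R] N -> M ⊗[R] N -> Z) :
  biadditive g -> biadditive h ->
  (forall m n m' n', g (m ⊗ n) (m' ⊗ n') = h (m ⊗ n) (m' ⊗ n')) ->
  forall t u, g t u = h t u.
Proof.
move=> [gl gr] [hl hr] gh t u.
apply: (tensor_ext (g := g^~ u) (h := h^~ u)) => // m n.
by apply: (tensor_ext (g := g _) (h := h _)).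
Qed.

(** Additivity in each of three arguments is expressed by biadditivity in the
first two and in the last two. *)
Lemma tensor_ext3 (Z : zmodType)
    (g h : M ⊗[R] N -> M ⊗[R] N -> M ⊗[R] N -> Z) :
  (forall v, biadditive (fun t u => g t u v)) -> (forall t, biadditive (g t)) ->
  (forall v, biadditive (fun t u => h t u v)) -> (forall t, biadditive (h t)) ->
  (forall m n m' n' m'' n'', g (m ⊗ n) (m' ⊗ n') (m'' ⊗ n'') =
    h (m ⊗ n) (m' ⊗ n') (m'' ⊗ n'')) ->
  forall t u v, g t u v = h t u v.
Proof.
move=> g12 g23 h12 h23 gh t u v.
apply: (tensor_ext (g := fun t => g t u v) (h := fun t => h t u v)) => [||m n].
- exact: (g12 v).1.
- exact: (h12 v).1.
by apply: (tensor_ext2 (g := g _) (h := h _)).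
Qed.

Section TensPoly.

Let monoD m n : biadditive (fun (a : M) (b : N) =>
  << a ⊗ b *g (m + n)%N >> : poly1 (M ⊗[R] N)).
Proof. by split=> ? x y; rewrite ?tensDl ?tensDr monomialD. Qed.

Lemma tens_polyD : biadditive (@tens_poly R M N).
Proof. exact: msupp_sum2D monoD. Qed.

Lemma tens_poly_monomial (a : M) (b : N) m n :
  tens_poly << a *g m >> << b *g n >> = << a ⊗ b *g (m + n)%N >>.
Proof. exact: msupp_sum2U monoD a b m n. Qed.

Implicit Types (w : poly1 M) (v : poly1 N) (F : poly2 M) (G : poly2 N) (c : R).

Lemma tens_poly_mulX_l w v : tens_poly (mulX w) v = mulX (tens_poly w v).
Proof.
have [Dl Dr] := tens_polyD.
apply: (fpoly_ext2 (f := fun (w : poly1 M) (v : poly1 N) => tens_poly (mulX w) v)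
  (g := fun (w : poly1 M) (v : poly1 N) => mulX (tens_poly w v))).
- by split=> ? x y; rewrite ?mulXD ?Dl ?Dr.
- by split=> ? x y; rewrite ?Dl ?Dr mulXD.
- by move=> a b m n; rewrite /mulX fpoly_shiftU !tens_poly_monomial fpoly_shiftU.
Qed.

Lemma tens_poly_mulX_r w v : tens_poly w (mulX v) = mulX (tens_poly w v).
Proof.
have [Dl Dr] := tens_polyD.
apply: (fpoly_ext2 (f := fun (w : poly1 M) (v : poly1 N) => tens_poly w (mulX v))
  (g := fun (w : poly1 M) (v : poly1 N) => mulX (tens_poly w v))).
- by split=> ? x y; rewrite ?mulXD ?Dl ?Dr.
- by split=> ? x y; rewrite ?Dl ?Dr mulXD.
- move=> a b m n; rewrite /mulX fpoly_shiftU !tens_poly_monomial fpoly_shiftU.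
  by rewrite addnS.
Qed.

Lemma tens_poly_scale_l c w v : tens_poly (c *: w) v = c *: tens_poly w v.
Proof.
have [Dl Dr] := tens_polyD.
apply: (fpoly_ext2 (f := fun (w : poly1 M) (v : poly1 N) => tens_poly (c *: w) v)
  (g := fun (w : poly1 M) (v : poly1 N) => c *: tens_poly w v)).
- by split=> ? x y; rewrite ?scalerDr ?Dl ?Dr.
- by split=> ? x y; rewrite ?Dl ?Dr scalerDr.
- by move=> a b m n; rewrite fpoly_scaleU !tens_poly_monomial fpoly_scaleU tensZl.
Qed.

Lemma tens_poly_scale_r c w v : tens_poly w (c *: v) = c *: tens_poly w v.
Proof.
have [Dl Dr] := tens_polyD.
apply: (fpoly_ext2 (f := fun (w : poly1 M) (v : poly1 N) => tens_poly w (c *: v))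
  (g := fun (w : poly1 M) (v : poly1 N) => c *: tens_poly w v)).
- by split=> ? x y; rewrite ?scalerDr ?Dl ?Dr.
- by split=> ? x y; rewrite ?Dl ?Dr scalerDr.
- by move=> a b m n; rewrite fpoly_scaleU !tens_poly_monomial fpoly_scaleU tensZr.
Qed.
End TensPoly.

Definition tens_poly2 (F : poly2 M) (G : poly2 N) : poly2 (M ⊗[R] N) :=
  \sum_(k <- msupp F) \sum_(l <- msupp G)
    << F@_k ⊗ G@_l *g (k.1 + l.1, k.2 + l.2)%N >>.

Section TensPoly2.
Implicit Types (F : poly2 M) (G : poly2 N) (c : R).

Let monoD (k l : nat * nat) : biadditive (fun (a : M) (b : N) =>
  << a ⊗ b *g (k.1 + l.1, k.2 + l.2)%N >> : poly2 (M ⊗[R] N)).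
Proof. by split=> ? x y; rewrite ?tensDl ?tensDr monomialD. Qed.

Lemma tens_poly2D : biadditive tens_poly2.
Proof. exact: msupp_sum2D monoD. Qed.

Lemma tens_poly2_monomial (a : M) (b : N) k l :
  tens_poly2 << a *g k >> << b *g l >> =
  << a ⊗ b *g (k.1 + l.1, k.2 + l.2)%N >>.
Proof. exact: msupp_sum2U monoD a b k l. Qed.

Lemma tens_poly2_cst (a : M) (b : N) : tens_poly2 (cst a) (cst b) = cst (a ⊗ b).
Proof. exact: tens_poly2_monomial. Qed.

Lemma tens_poly2_polylinear_l G : polylinear (tens_poly2^~ G).
Proof.
have [Dl Dr] := tens_poly2D; split=> [|F|F]; first exact: Dl.
- apply: (fpoly_ext2 (f := fun (F : poly2 M) (G : poly2 N) => tens_poly2 (lam F) G)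
    (g := fun (F : poly2 M) (G : poly2 N) => lam (tens_poly2 F G))).
  + by split=> ? x y; rewrite ?lamD ?Dl ?Dr.
  + by split=> ? x y; rewrite ?Dl ?Dr lamD.
  + by move=> a b k l; rewrite /lam fpoly_shiftU !tens_poly2_monomial fpoly_shiftU.
- apply: (fpoly_ext2 (f := fun (F : poly2 M) (G : poly2 N) => tens_poly2 (mu F) G)
    (g := fun (F : poly2 M) (G : poly2 N) => mu (tens_poly2 F G))).
  + by split=> ? x y; rewrite ?muD ?Dl ?Dr.
  + by split=> ? x y; rewrite ?Dl ?Dr muD.
  + by move=> a b k l; rewrite /mu fpoly_shiftU !tens_poly2_monomial fpoly_shiftU.
Qed.

Lemma tens_poly2_polylinear_r F : polylinear (tens_poly2 F).
Proof.
have [Dl Dr] := tens_poly2D; split=> [|G|G]; first exact: Dr.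
- apply: (fpoly_ext2 (f := fun (F : poly2 M) (G : poly2 N) => tens_poly2 F (lam G))
    (g := fun (F : poly2 M) (G : poly2 N) => lam (tens_poly2 F G))).
  + by split=> ? x y; rewrite ?lamD ?Dl ?Dr.
  + by split=> ? x y; rewrite ?Dl ?Dr lamD.
  + move=> a b k l; rewrite /lam fpoly_shiftU !tens_poly2_monomial fpoly_shiftU.
    by rewrite addnS.
- apply: (fpoly_ext2 (f := fun (F : poly2 M) (G : poly2 N) => tens_poly2 F (mu G))
    (g := fun (F : poly2 M) (G : poly2 N) => mu (tens_poly2 F G))).
  + by split=> ? x y; rewrite ?muD ?Dl ?Dr.
  + by split=> ? x y; rewrite ?Dl ?Dr muD.
  + move=> a b k l; rewrite /mu fpoly_shiftU !tens_poly2_monomial fpoly_shiftU.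
    by rewrite addnS.
Qed.

Lemma tens_poly2_scale_l c F G : tens_poly2 (c *: F) G = c *: tens_poly2 F G.
Proof.
have [Dl Dr] := tens_poly2D.
apply: (fpoly_ext2 (f := fun (F : poly2 M) (G : poly2 N) => tens_poly2 (c *: F) G)
  (g := fun (F : poly2 M) (G : poly2 N) => c *: tens_poly2 F G)).
- by split=> ? x y; rewrite ?scalerDr ?Dl ?Dr.
- by split=> ? x y; rewrite ?Dl ?Dr scalerDr.
- by move=> a b k l; rewrite fpoly_scaleU !tens_poly2_monomial fpoly_scaleU tensZl.
Qed.

Lemma tens_poly2_scale_r c F G : tens_poly2 F (c *: G) = c *: tens_poly2 F G.
Proof.
have [Dl Dr] := tens_poly2D.
apply: (fpoly_ext2 (f := fun (F : poly2 M) (G : poly2 N) => tens_poly2 F (c *: G))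
  (g := fun (F : poly2 M) (G : poly2 N) => c *: tens_poly2 F G)).
- by split=> ? x y; rewrite ?scalerDr ?Dl ?Dr.
- by split=> ? x y; rewrite ?Dl ?Dr scalerDr.
- by move=> a b k l; rewrite fpoly_scaleU !tens_poly2_monomial fpoly_scaleU tensZr.
Qed.
End TensPoly2.
End TensorMaps.

(** * Tensor products of conformal products *)

Section TensorProduct.
Context {K : fieldType} {M N : lmodType {poly K}}.
Local Notation L := (M ⊗[{poly K}] N).

Lemma tens_poly2_op_l s (F : poly2 M) (G : poly2 N) :
  tens_poly2 (op s F) G = op s (tens_poly2 F G).
Proof.
have [D l m] := tens_poly2_polylinear_l (M := M) G.
apply: (op_equivariant (g := fun F => tens_poly2 F G)) => // p.
exact: tens_poly2_scale_l.
Qed.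

Lemma tens_poly2_op_r s (F : poly2 M) (G : poly2 N) :
  tens_poly2 F (op s G) = op s (tens_poly2 F G).
Proof.
have [D l m] := tens_poly2_polylinear_r (N := N) F.
apply: (op_equivariant (g := tens_poly2 F)) => // p.
exact: tens_poly2_scale_r.
Qed.

(** Evaluation at [s] turns the exponent [m + n] into [s] applied [m + n] times,
which can be distributed over the factors since [∂], [λ] and [μ] act through
either of them. *)
Lemma feval_tens s (w : poly1 M) (v : poly1 N) :
  feval (op s) (tens_poly w v : poly1 L) =
  tens_poly2 (feval (op s) w) (feval (op s) v).
Proof.
have [Dl Dr] := @tens_polyD _ M N; have [D2l D2r] := @tens_poly2D _ M N.
apply: (poly1_ext (phi := op s) (f := fun w => feval (op s) (tens_poly w v))
  (g := fun w => tens_poly2 (feval (op s) w) (feval (op s) v))).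
- by move=> x y; rewrite Dl fevalD.
- by move=> x y; rewrite fevalD D2l.
- by move=> p; rewrite tens_poly_mulX_l feval_mulX.
- by move=> p; rewrite feval_mulX tens_poly2_op_l.
move=> a; apply: (poly1_ext (phi := op s)
  (f := fun v => feval (op s) (tens_poly (cst1 a) v))
  (g := fun v => tens_poly2 (feval (op s) (cst1 a)) (feval (op s) v))).
- by move=> x y; rewrite Dr fevalD.
- by move=> x y; rewrite fevalD D2r.
- by move=> p; rewrite tens_poly_mulX_r feval_mulX.
- by move=> p; rewrite feval_mulX tens_poly2_op_r.
move=> b; rewrite tens_poly_monomial.
by rewrite !feval_cst1 tens_poly2_cst.
Qed.

Definition is_tensor_product (f1 : M -> M -> poly1 M) (f2 : N -> N -> poly1 N)
    (f : L -> L -> poly1 L) :=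
  forall a1 b1 a2 b2, f (a1 ⊗ a2) (b1 ⊗ b2) = tens_poly (f1 a1 b1) (f2 a2 b2).

(** The factorisation of products at every [s], which makes iterated products of
pure tensors factor as well. *)
Lemma xprod_tens f1 f2 f : is_tensor_product f1 f2 f ->
  biadditive f1 -> biadditive f2 -> biadditive f ->
  forall s F1 F2 G1 G2,
  xprod f (op s) (tens_poly2 F1 F2) (tens_poly2 G1 G2) =
  tens_poly2 (xprod f1 (op s) F1 G1) (xprod f2 (op s) F2 G2).
Proof.
move=> ff f1B f2B fB s F1 F2 G1 G2.
apply: (polylinear_ext
  (polylinear_comp (xprod_polylinear_l fB s _) (tens_poly2_polylinear_l F2))
  (polylinear_comp (tens_poly2_polylinear_l _) (xprod_polylinear_l f1B s G1))).
move=> a1; apply: (polylinear_ext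
  (polylinear_comp (xprod_polylinear_l fB s _) (tens_poly2_polylinear_r _))
  (polylinear_comp (tens_poly2_polylinear_r _) (xprod_polylinear_l f2B s G2))).
move=> a2; apply: (polylinear_ext
  (polylinear_comp (xprod_polylinear_r fB s _) (tens_poly2_polylinear_l G2))
  (polylinear_comp (tens_poly2_polylinear_l _) (xprod_polylinear_r f1B s _))).
move=> b1; apply: (polylinear_ext
  (polylinear_comp (xprod_polylinear_r fB s _) (tens_poly2_polylinear_r _))
  (polylinear_comp (tens_poly2_polylinear_r _) (xprod_polylinear_r f2B s _))).
move=> b2; rewrite !tens_poly2_cst (xprod_cst fB) (xprod_cst f1B) (xprod_cst f2B).
by rewrite ff feval_tens.
Qed.

Section Lift.
Variables (f1 : M -> M -> poly1 M) (f2 : N -> N -> poly1 N).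
Hypotheses (f1C : conformal f1) (f2C : conformal f2).
Let f1B := conformal_biadditive f1C.
Let f2B := conformal_biadditive f2C.

Local Notation g a1 a2 b1 b2 := (tens_poly (f1 a1 b1) (f2 a2 b2) : poly1 L).

(** Both sides are multiplied by [∂+λ] when [p] is multiplied by [∂], so that
the balance condition follows by induction on [p]. *)
Let g_balanced_r (p : {poly K}) : forall a1 a2 b1 b2,
  g a1 a2 (p *: b1) b2 = g a1 a2 b1 (p *: b2).
Proof.
have [Dl Dr] := @tens_polyD _ M N.
elim/poly_ind: p => [|p c IH] a1 a2 b1 b2.
  rewrite !scale0r (additive_map0 (f1B.2 _)) (additive_map0 (f2B.2 _)).
  by rewrite (additive_map0 (Dl _)) (additive_map0 (Dr _)).
have EC : g a1 a2 (c%:P *: b1) b2 = g a1 a2 b1 (c%:P *: b2).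
  rewrite (conformal_scale f1C c a1 b1).2 (conformal_scale f2C c a2 b2).2.
  by rewrite tens_poly_scale_l tens_poly_scale_r.
have EX b2' : g a1 a2 ('X *: b1) b2' = g a1 a2 b1 ('X *: b2').
  have [_ _ ->] := f1C; have [_ _ ->] := f2C; rewrite Dl Dr.
  by rewrite tens_poly_scale_l tens_poly_scale_r tens_poly_mulX_l tens_poly_mulX_r.
rewrite !scalerDl -(scalerA p 'X b1) (mulrC p) -(scalerA 'X p b2).
by rewrite (f1B.2 _ _ _) (f2B.2 _ _ _) Dl Dr IH EX EC.
Qed.

Let g_balanced_l (p : {poly K}) : forall a1 a2 b1 b2,
  g (p *: a1) a2 b1 b2 = g a1 (p *: a2) b1 b2.
Proof.
have [Dl Dr] := @tens_polyD _ M N.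
elim/poly_ind: p => [|p c IH] a1 a2 b1 b2.
  rewrite !scale0r (additive_map0 (f1B.1 _)) (additive_map0 (f2B.1 _)).
  by rewrite (additive_map0 (Dl _)) (additive_map0 (Dr _)).
have EC : g (c%:P *: a1) a2 b1 b2 = g a1 (c%:P *: a2) b1 b2.
  rewrite (conformal_scale f1C c a1 b1).1 (conformal_scale f2C c a2 b2).1.
  by rewrite tens_poly_scale_l tens_poly_scale_r.
have EX a2' : g ('X *: a1) a2' b1 b2 = g a1 ('X *: a2') b1 b2.
  have [_ -> _] := f1C; have [_ -> _] := f2C.
  rewrite (additive_mapN (Dl _)) (additive_mapN (Dr _)).
  by rewrite tens_poly_mulX_l tens_poly_mulX_r.
rewrite !scalerDl -(scalerA p 'X a1) (mulrC p) -(scalerA 'X p a2).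
by rewrite (f1B.1 _ _ _) (f2B.1 _ _ _) Dl Dr IH EX EC.
Qed.

(** The universal property is used once in each argument. The lift in the second
argument is taken first, with the first argument a pure tensor; then, for each
fixed second argument, the result is lifted in the first. *)
Lemma tensor_product_exists :
  exists2 f, biadditive f & is_tensor_product f1 f2 f.
Proof.
have [Dl Dr] := @tens_polyD _ M N.
have right_lift a1 a2 : {h : {additive L -> poly1 L} |
    forall b1 b2, h (b1 ⊗ b2) = g a1 a2 b1 b2}.
  apply: cid; apply: tensor_lift => [b b' c|b c c'|p b c].
  - by rewrite (f1B.2 _ _ _) Dl.
  - by rewrite (f2B.2 _ _ _) Dr.
  - exact: g_balanced_r.
have [h hD hE] : exists2 h : M -> N -> L -> poly1 L,
    forall a1 a2, additive_map (h a1 a2) &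
    forall a1 a2 b1 b2, h a1 a2 (b1 ⊗ b2) = g a1 a2 b1 b2.
  exists (fun a1 a2 => sval (right_lift a1 a2)) => a1 a2; first exact: raddfD.
  exact: (svalP (right_lift a1 a2)).
have left_lift y : {k : {additive L -> poly1 L} |
    forall a1 a2, k (a1 ⊗ a2) = h a1 a2 y}.
  apply: cid; apply: tensor_lift => [a a' b|a b b'|p a b].
  - apply: (tensor_ext (g := h (a + a') b) (h := fun y => h a b y + h a' b y)).
    + exact: hD.
    + by move=> x z; rewrite (hD a) (hD a') addrACA.
    + by move=> m n; rewrite (hE a) (hE a') (hE (a + a')) (f1B.1 _ _ _) Dl.
  - apply: (tensor_ext (g := h a (b + b')) (h := fun y => h a b y + h a b' y)).
    + exact: hD.
    + by move=> x z; rewrite (hD a b) (hD a b') addrACA.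
    + by move=> m n; rewrite (hE a b) (hE a b') (hE a (b + b')) (f2B.1 _ _ _) Dr.
  - apply: (tensor_ext (g := h (p *: a) b) (h := h a (p *: b))).
    + exact: hD.
    + exact: hD.
    + by move=> m n; rewrite (hE (p *: a)) (hE a) g_balanced_l.
have [f fD fE] : exists2 f : L -> L -> poly1 L,
    forall y, additive_map (f^~ y) &
    forall a1 a2 y, f (a1 ⊗ a2) y = h a1 a2 y.
  exists (fun x y => sval (left_lift y) x) => [y|a1 a2 y]; first exact: raddfD.
  exact: (svalP (left_lift y)).
exists f; last by move=> a1 b1 a2 b2; rewrite fE hE.
split=> // x y z.
apply: (tensor_ext (g := f^~ (y + z)) (h := fun x => f x y + f x z)).
- exact: fD.
- by move=> u v; rewrite (fD y) (fD z) addrACA.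
- by move=> m n; rewrite (fE m n y) (fE m n z) (fE m n (y + z)) hD.
Qed.

Lemma tensor_product_conformal f : biadditive f -> is_tensor_product f1 f2 f ->
  conformal f.
Proof.
move=> fB ff; have [Dl Dr] := @tens_polyD _ M N; have [fl fr] := fB.
have scalel (k : K) a b : f (k%:P *: a) b = k%:P *: f a b.
  apply: (tensor_ext2 (g := fun a b => f (k%:P *: a) b)
    (h := fun a b => k%:P *: f a b)).
  - by split=> ? x y; rewrite ?scalerDr (fl, fr).
  - by split=> ? x y; rewrite (fl, fr) scalerDr.
  - move=> a1 a2 b1 b2; rewrite tensZl !ff.
    by rewrite (conformal_scale f1C k a1 b1).1 tens_poly_scale_l.
have scaler (k : K) a b : f a (k%:P *: b) = k%:P *: f a b.
  apply: (tensor_ext2 (g := fun a b => f a (k%:P *: b))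
    (h := fun a b => k%:P *: f a b)).
  - by split=> ? x y; rewrite ?scalerDr (fl, fr).
  - by split=> ? x y; rewrite (fl, fr) scalerDr.
  - move=> a1 a2 b1 b2; rewrite tensZl !ff.
    by rewrite (conformal_scale f1C k a1 b1).2 tens_poly_scale_l.
split; first by split=> k a b c; rewrite (fl, fr) (scalel, scaler).
- apply: (tensor_ext2 (g := fun a b => f ('X *: a) b)
    (h := fun a b => - mulX (f a b))).
  + by split=> ? x y; rewrite ?scalerDr (fl, fr).
  + by split=> ? x y; rewrite (fl, fr) mulXD opprD.
  + move=> a1 a2 b1 b2; rewrite tensZl !ff; have [_ -> _] := f1C.
    by rewrite (additive_mapN (Dl _)) tens_poly_mulX_l.
- apply: (tensor_ext2 (g := fun a b => f a ('X *: b))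
    (h := fun a b => 'X *: f a b + mulX (f a b))).
  + by split=> ? x y; rewrite ?scalerDr (fl, fr).
  + by split=> ? x y; rewrite (fl, fr) mulXD scalerDr addrACA.
  + move=> a1 a2 b1 b2; rewrite tensZl !ff; have [_ _ ->] := f1C.
    by rewrite Dl tens_poly_scale_l tens_poly_mulX_l.
Qed.
End Lift.
End TensorProduct.

(** * Bilinear identities *)

Section BilinearIdentities.
Context {U V W : zmodType} {T : U -> V -> W}.
Hypothesis TB : biadditive T.

(** Compatibility on pure tensors. The [A] are associative triple products, which
agree for all three arrangements of their arguments, and [T] is the tensor
product. *)
Lemma compat_terms (P Qb Qc Aa Ab Ac : U) (P' Qb' Qc' Aa' Ab' Ac' : V) :
  Aa = Ac -> Ab = Ac -> Aa' = Ac' -> Ab' = Ac' ->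
  P *+ 2 = Qc + Qb -> P' *+ 2 = Qc' + Qb' ->
  T P Aa' + T Aa P' + (T P Aa' + T Aa P') =
  T Qc Ac' + T Ac Qc' + (T Qb Ab' + T Ab Qb').
Proof.
move=> -> -> -> -> e e'; have [Tl Tr] := TB.
by rewrite addrACA -Tl -Tr -!mulr2n e e' Tl Tr addrACA.
Qed.

Lemma cross_terms_sum (p q r s u v : W) :
  p + q + (r + s) = r - u + (p - v) + (v + s + (u + q)).
Proof.
rewrite (addrACA r) -opprD (addrACA v) (addrC v u) [RHS]addrA subrK.
by rewrite (addrC r) (addrC s) addrACA.
Qed.

(** The mixed terms of the Jacobi identity. The doubled relations eliminate the
[P]; the remaining sum of terms [T Q Q'] is the same on both sides. *)
Lemma cross_terms
    (Pa Pb Pc Qa Qb Qc : U) (Pa' Pb' Pc' Qa' Qb' Qc' : V) :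
  (forall x : W, x *+ 2 = 0 -> x = 0) ->
  Pa *+ 2 = Qc + Qb -> Pb *+ 2 = Qc + Qa -> Pc *+ 2 = Qa - Qb ->
  Pa' *+ 2 = Qc' + Qb' -> Pb' *+ 2 = Qc' + Qa' -> Pc' *+ 2 = Qa' - Qb' ->
  T Qa Pa' + T Pa Qa' = (T Qc Pc' + T Pc Qc') + (T Qb Pb' + T Pb Qb').
Proof.
move=> W2 ea eb ec ea' eb' ec'; have [Tl Tr] := TB.
have T2l x y : T x y *+ 2 = T (x *+ 2) y by rewrite !mulr2n Tl.
have T2r x y : T x y *+ 2 = T x (y *+ 2) by rewrite !mulr2n Tr.
apply/eqP; rewrite -subr_eq0; apply/eqP/W2.
rewrite mulrnBl !mulrnDl !(T2r _ Pa') !(T2r _ Pb') !(T2r _ Pc').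
rewrite !(T2l Pa) !(T2l Pb) !(T2l Pc) ea eb ec ea' eb' ec' !Tl !Tr.
rewrite (additive_mapN (Tl _)) (additive_mapN (Tr _)).
by apply/eqP; rewrite subr_eq0; apply/eqP/cross_terms_sum.
Qed.

Lemma Jacobi_sum (ja jb jc ka kb kc pa pb pc qa qb qc : W) :
  ja = jc + jb -> ka = kc + kb ->
  qa + pa = (qc + pc) + (qb + pb) ->
  ja + pa + (qa + ka) = jc + pc + (qc + kc) + (jb + pb + (qb + kb)).
Proof.
have shuffle (j p q k : W) : j + p + (q + k) = j + k + (q + p).
  by rewrite (addrC q k) addrACA (addrC p q).
move=> -> -> e; rewrite (shuffle (jc + jb)) (shuffle jc pc) (shuffle jb pb) e.
by rewrite (addrACA jc jb) (addrACA (jc + kc)).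
Qed.

(** The Jacobi identity on pure tensors: [J] stands for double brackets, [A] for
triple products, [P] and [Q] for the mixed expressions. *)
Lemma Jacobi_terms
    (Pa Pb Pc Qa Qb Qc Ja Jb Jc Aa Ab Ac : U)
    (Pa' Pb' Pc' Qa' Qb' Qc' Ja' Jb' Jc' Aa' Ab' Ac' : V) :
  (forall x : W, x *+ 2 = 0 -> x = 0) ->
  Pa *+ 2 = Qc + Qb -> Pb *+ 2 = Qc + Qa -> Pc *+ 2 = Qa - Qb ->
  Pa' *+ 2 = Qc' + Qb' -> Pb' *+ 2 = Qc' + Qa' -> Pc' *+ 2 = Qa' - Qb' ->
  Aa = Ac -> Ab = Ac -> Aa' = Ac' -> Ab' = Ac' ->
  Ja = Jc + Jb -> Ja' = Jc' + Jb' ->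
  T Ja Aa' + T Pa Qa' + (T Qa Pa' + T Aa Ja') =
  T Jc Ac' + T Pc Qc' + (T Qc Pc' + T Ac Jc') +
  (T Jb Ab' + T Pb Qb' + (T Qb Pb' + T Ab Jb')).
Proof.
move=> W2 ea eb ec ea' eb' ec' -> -> -> -> -> ->; have [Tl Tr] := TB.
by apply: Jacobi_sum; [apply: Tl | apply: Tr | apply: cross_terms].
Qed.
End BilinearIdentities.

(** * The tensor product of transposed Poisson conformal algebras *)

Section Assembly.
Context {K : fieldType} {M N : lmodType {poly K}}.
Local Notation L := (M ⊗[{poly K}] N).

Lemma double_eq0 (A : lmodType {poly K}) (x : poly2 A) :
  (2 : K) != 0 -> x *+ 2 = 0 -> x = 0.
Proof.
move=> two_neq0 x2.
have : (2^-1 : K)%:P *: (x *+ 2) = 0 by rewrite x2 scaler0.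
by rewrite -scaler_nat scalerA -polyC_natr -polyCM mulVf // scale1r.
Qed.

Section Structure.
Variables (circ1 brk1 : M -> M -> poly1 M) (circ2 brk2 : N -> N -> poly1 N).
Hypotheses (H1 : TPCA circ1 brk1) (H2 : TPCA circ2 brk2).
Let circ1B := conformal_biadditive (TPCA_circ_conformal H1).
Let brk1B := conformal_biadditive (TPCA_brk_conformal H1).
Let circ2B := conformal_biadditive (TPCA_circ_conformal H2).
Let brk2B := conformal_biadditive (TPCA_brk_conformal H2).

(** The two summands [brkl] and [brkr] of the bracket are tensor products of
conformal products, whereas their sum is not. *)
Variables circ brkl brkr : L -> L -> poly1 L.
Hypotheses (circB : biadditive circ) (brklB : biadditive brkl)
  (brkrB : biadditive brkr).
Hypotheses (circT : is_tensor_product circ1 circ2 circ)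
  (brklT : is_tensor_product brk1 circ2 brkl)
  (brkrT : is_tensor_product circ1 brk2 brkr).

Definition brk_sum a b := brkl a b + brkr a b.
Local Notation brk := brk_sum.
Local Notation LamMu := (Add Lam Mu).
Local Notation T := (@tens_poly2 _ M N).

Lemma brk_biadditive : biadditive brk.
Proof.
split=> a x y; rewrite /brk_sum.
  by rewrite (brklB.1 _ _ _) (brkrB.1 _ _ _) addrACA.
by rewrite (brklB.2 _ _ _) (brkrB.2 _ _ _) addrACA.
Qed.
Let brkB := brk_biadditive.

Let circX := xprod_tens circT circ1B circ2B circB.
Let brkX s F1 F2 G1 G2 : xprod brk (op s) (T F1 F2) (T G1 G2) =
  T (xprod brk1 (op s) F1 G1) (xprod circ2 (op s) F2 G2) +
  T (xprod circ1 (op s) F1 G1) (xprod brk2 (op s) F2 G2).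
Proof.
rewrite (xprod_sum brkl brkr s).
by rewrite (xprod_tens brklT brk1B circ2B brklB) (xprod_tens brkrT circ1B brk2B brkrB).
Qed.

Lemma circ_circX_r s t F1 F2 G1 G2 E1 E2 :
  xprod circ (op s) (T F1 F2) (xprod circ (op t) (T G1 G2) (T E1 E2)) =
  T (xprod circ1 (op s) F1 (xprod circ1 (op t) G1 E1))
    (xprod circ2 (op s) F2 (xprod circ2 (op t) G2 E2)).
Proof. exact: etrans (congr1 _ (circX t _ _ _ _)) (circX s _ _ _ _). Qed.

Lemma circ_circX_l s t F1 F2 G1 G2 E1 E2 :
  xprod circ (op s) (xprod circ (op t) (T F1 F2) (T G1 G2)) (T E1 E2) =
  T (xprod circ1 (op s) (xprod circ1 (op t) F1 G1) E1)
    (xprod circ2 (op s) (xprod circ2 (op t) F2 G2) E2).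
Proof.
exact: etrans (congr1 (xprod circ (op s) ^~ _) (circX t _ _ _ _)) (circX s _ _ _ _).
Qed.

Lemma circ_brkX_r s t F1 F2 G1 G2 E1 E2 :
  xprod circ (op s) (T F1 F2) (xprod brk (op t) (T G1 G2) (T E1 E2)) =
  T (xprod circ1 (op s) F1 (xprod brk1 (op t) G1 E1))
    (xprod circ2 (op s) F2 (xprod circ2 (op t) G2 E2)) +
  T (xprod circ1 (op s) F1 (xprod circ1 (op t) G1 E1))
    (xprod circ2 (op s) F2 (xprod brk2 (op t) G2 E2)).
Proof.
apply: etrans (congr1 _ (brkX t _ _ _ _)) _.
apply: etrans ((xprodD circB s).2 _ _ _) _.
exact: congr2 (circX s _ _ _ _) (circX s _ _ _ _).
Qed.

Lemma brk_circX_r s t F1 F2 G1 G2 E1 E2 :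
  xprod brk (op s) (T F1 F2) (xprod circ (op t) (T G1 G2) (T E1 E2)) =
  T (xprod brk1 (op s) F1 (xprod circ1 (op t) G1 E1))
    (xprod circ2 (op s) F2 (xprod circ2 (op t) G2 E2)) +
  T (xprod circ1 (op s) F1 (xprod circ1 (op t) G1 E1))
    (xprod brk2 (op s) F2 (xprod circ2 (op t) G2 E2)).
Proof. exact: etrans (congr1 _ (circX t _ _ _ _)) (brkX s _ _ _ _). Qed.

Lemma brk_circX_l s t F1 F2 G1 G2 E1 E2 :
  xprod brk (op s) (xprod circ (op t) (T F1 F2) (T G1 G2)) (T E1 E2) =
  T (xprod brk1 (op s) (xprod circ1 (op t) F1 G1) E1)
    (xprod circ2 (op s) (xprod circ2 (op t) F2 G2) E2) +
  T (xprod circ1 (op s) (xprod circ1 (op t) F1 G1) E1)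
    (xprod brk2 (op s) (xprod circ2 (op t) F2 G2) E2).
Proof.
exact: etrans (congr1 (xprod brk (op s) ^~ _) (circX t _ _ _ _)) (brkX s _ _ _ _).
Qed.

Lemma brk_brkX_r s t F1 F2 G1 G2 E1 E2 :
  xprod brk (op s) (T F1 F2) (xprod brk (op t) (T G1 G2) (T E1 E2)) =
  T (xprod brk1 (op s) F1 (xprod brk1 (op t) G1 E1))
    (xprod circ2 (op s) F2 (xprod circ2 (op t) G2 E2)) +
  T (xprod circ1 (op s) F1 (xprod brk1 (op t) G1 E1))
    (xprod brk2 (op s) F2 (xprod circ2 (op t) G2 E2)) +
  (T (xprod brk1 (op s) F1 (xprod circ1 (op t) G1 E1))
     (xprod circ2 (op s) F2 (xprod brk2 (op t) G2 E2)) +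
   T (xprod circ1 (op s) F1 (xprod circ1 (op t) G1 E1))
     (xprod brk2 (op s) F2 (xprod brk2 (op t) G2 E2))).
Proof.
apply: etrans (congr1 _ (brkX t _ _ _ _)) _.
apply: etrans ((xprodD brkB s).2 _ _ _) _.
exact: congr2 (brkX s _ _ _ _) (brkX s _ _ _ _).
Qed.

Lemma brk_brkX_l s t F1 F2 G1 G2 E1 E2 :
  xprod brk (op s) (xprod brk (op t) (T F1 F2) (T G1 G2)) (T E1 E2) =
  T (xprod brk1 (op s) (xprod brk1 (op t) F1 G1) E1)
    (xprod circ2 (op s) (xprod circ2 (op t) F2 G2) E2) +
  T (xprod circ1 (op s) (xprod brk1 (op t) F1 G1) E1)
    (xprod brk2 (op s) (xprod circ2 (op t) F2 G2) E2) +
  (T (xprod brk1 (op s) (xprod circ1 (op t) F1 G1) E1)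
     (xprod circ2 (op s) (xprod brk2 (op t) F2 G2) E2) +
   T (xprod circ1 (op s) (xprod circ1 (op t) F1 G1) E1)
     (xprod brk2 (op s) (xprod brk2 (op t) F2 G2) E2)).
Proof.
apply: etrans (congr1 (xprod brk (op s) ^~ _) (brkX t _ _ _ _)) _.
apply: etrans ((xprodD brkB s).1 _ _ _) _.
exact: congr2 (brkX s _ _ _ _) (brkX s _ _ _ _).
Qed.

Lemma nested_biadditive_r (f g : L -> L -> poly1 L) s t :
  biadditive f -> biadditive g ->
  (forall c, biadditive (fun a b =>
    xprod f (op s) (cst a) (xprod g (op t) (cst b) (cst c)))) *
  (forall a, biadditive (fun b c =>
    xprod f (op s) (cst a) (xprod g (op t) (cst b) (cst c)))).
Proof.
move=> fB gB; have [fl fr] := xprodD fB s; have [gl gr] := xprodD gB t.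
split=> [c|a]; split=> ? x y; rewrite cstD.
- exact: fl.
- by rewrite (gl _ _ _) (fr _ _ _).
- by rewrite (gl _ _ _) (fr _ _ _).
- by rewrite (gr _ _ _) (fr _ _ _).
Qed.

Lemma nested_biadditive_l (f g : L -> L -> poly1 L) s t :
  biadditive f -> biadditive g ->
  (forall c, biadditive (fun a b =>
    xprod f (op s) (xprod g (op t) (cst a) (cst b)) (cst c))) *
  (forall a, biadditive (fun b c =>
    xprod f (op s) (xprod g (op t) (cst a) (cst b)) (cst c))).
Proof.
move=> fB gB; have [fl fr] := xprodD fB s; have [gl gr] := xprodD gB t.
split=> [c|a]; split=> ? x y; rewrite cstD.
- by rewrite (gl _ _ _) (fl _ _ _).
- by rewrite (gr _ _ _) (fl _ _ _).
- by rewrite (gr _ _ _) (fl _ _ _).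
- exact: fr.
Qed.

Lemma nested_biadditive_m (f g : L -> L -> poly1 L) s t :
  biadditive f -> biadditive g ->
  (forall c, biadditive (fun a b =>
    xprod f (op s) (cst b) (xprod g (op t) (cst a) (cst c)))) *
  (forall a, biadditive (fun b c =>
    xprod f (op s) (cst b) (xprod g (op t) (cst a) (cst c)))).
Proof.
move=> fB gB; have [fl fr] := xprodD fB s; have [gl gr] := xprodD gB t.
split=> [c|a]; split=> ? x y; rewrite cstD.
- by rewrite (gl _ _ _) (fr _ _ _).
- exact: fl.
- exact: fl.
- by rewrite (gr _ _ _) (fr _ _ _).
Qed.

Lemma tensor_comm a b :
  xprod circ (op Lam) (cst a) (cst b) =
  xprod circ (op (mirror Lam)) (cst b) (cst a).
Proof.
have [D1 D2] := xprodD circB Lam; have [E1 E2] := xprodD circB (mirror Lam).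
apply: (tensor_ext2 (g := fun a b => xprod circ (op Lam) (cst a) (cst b))
  (h := fun a b => xprod circ (op (mirror Lam)) (cst b) (cst a))).
- by split=> ? x y; rewrite cstD; [apply: D1 | apply: D2].
- by split=> ? x y; rewrite cstD; [apply: E2 | apply: E1].
move=> a1 a2 b1 b2; rewrite -!tens_poly2_cst !circX.
by rewrite (TPCA_comm H1 Lam) (TPCA_comm H2 Lam).
Qed.

Lemma tensor_skew a b :
  xprod brk (op Lam) (cst a) (cst b) =
  - xprod brk (op (mirror Lam)) (cst b) (cst a).
Proof.
have [D1 D2] := xprodD brkB Lam; have [E1 E2] := xprodD brkB (mirror Lam).
apply: (tensor_ext2 (g := fun a b => xprod brk (op Lam) (cst a) (cst b))
  (h := fun a b => - xprod brk (op (mirror Lam)) (cst b) (cst a))).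
- by split=> ? x y; rewrite cstD; [apply: D1 | apply: D2].
- by split=> ? x y; rewrite cstD ?(E1 _ _ _) ?(E2 _ _ _) opprD.
move=> a1 a2 b1 b2; rewrite -!tens_poly2_cst !brkX.
rewrite (TPCA_comm H1 Lam) (TPCA_comm H2 Lam).
rewrite (TPCA_skew H1 Lam) (TPCA_skew H2 Lam).
have [Tl Tr] := @tens_poly2D _ M N.
by rewrite (additive_mapN (Tl _)) (additive_mapN (Tr _)) opprD.
Qed.

Lemma tensor_assoc a b c :
  xprod circ (op Lam) (cst a) (xprod circ (op Mu) (cst b) (cst c)) =
  xprod circ (op LamMu) (xprod circ (op Lam) (cst a) (cst b)) (cst c).
Proof.
have r := nested_biadditive_r Lam Mu circB circB.
have l := nested_biadditive_l LamMu Lam circB circB.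
apply: (tensor_ext3 r.1 r.2 l.1 l.2) => a1 a2 b1 b2 c1 c2.
rewrite -!tens_poly2_cst; apply: etrans (circ_circX_r _ _ _ _ _ _ _ _) _.
apply: etrans (esym (circ_circX_l _ _ _ _ _ _ _ _)).
exact: congr2 (TPCA_assoc H1 _ _ _) (TPCA_assoc H2 _ _ _).
Qed.

Lemma tensor_compat a b c :
  xprod circ (op Lam) (cst a) (xprod brk (op Mu) (cst b) (cst c)) *+ 2 =
  xprod brk (op LamMu) (xprod circ (op Lam) (cst a) (cst b)) (cst c) +
  xprod brk (op Mu) (cst b) (xprod circ (op Lam) (cst a) (cst c)).
Proof.
have r := nested_biadditive_r Lam Mu circB brkB.
have l := nested_biadditive_l LamMu Lam brkB circB.
have m := nested_biadditive_m Mu Lam brkB circB.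
rewrite mulr2n; apply: (tensor_ext3
  (fun c => biadditive_add (r.1 c) (r.1 c)) (fun a => biadditive_add (r.2 a) (r.2 a))
  (fun c => biadditive_add (l.1 c) (m.1 c)) (fun a => biadditive_add (l.2 a) (m.2 a))).
move=> a1 a2 b1 b2 c1 c2; rewrite -!tens_poly2_cst.
have e := circ_brkX_r Lam Mu (cst a1) (cst a2) (cst b1) (cst b2) (cst c1) (cst c2).
apply: etrans (congr2 +%R e e) _.
apply: etrans _ (esym (congr2 +%R (brk_circX_l _ _ _ _ _ _ _ _)
  (brk_circX_r _ _ _ _ _ _ _ _))).
exact: (compat_terms (@tens_poly2D _ M N) (TPCA_assoc H1 a1 b1 c1)
  (TPCA_assoc_swap H1 a1 b1 c1) (TPCA_assoc H2 a2 b2 c2)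
  (TPCA_assoc_swap H2 a2 b2 c2) (TPCA_compat H1 a1 b1 c1)
  (TPCA_compat H2 a2 b2 c2)).
Qed.

Lemma tensor_Jacobi a b c : (2 : K) != 0 ->
  xprod brk (op Lam) (cst a) (xprod brk (op Mu) (cst b) (cst c)) =
  xprod brk (op LamMu) (xprod brk (op Lam) (cst a) (cst b)) (cst c) +
  xprod brk (op Mu) (cst b) (xprod brk (op Lam) (cst a) (cst c)).
Proof.
move=> two_neq0.
have r := nested_biadditive_r Lam Mu brkB brkB.
have l := nested_biadditive_l LamMu Lam brkB brkB.
have m := nested_biadditive_m Mu Lam brkB brkB.
apply: (tensor_ext3 r.1 r.2
  (fun c => biadditive_add (l.1 c) (m.1 c)) (fun a => biadditive_add (l.2 a) (m.2 a))).
move=> a1 a2 b1 b2 c1 c2; rewrite -!tens_poly2_cst.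
apply: etrans (brk_brkX_r _ _ _ _ _ _ _ _) _.
apply: etrans _ (esym (congr2 +%R (brk_brkX_l _ _ _ _ _ _ _ _)
  (brk_brkX_r _ _ _ _ _ _ _ _))).
exact: (Jacobi_terms (@tens_poly2D _ M N) (fun x => double_eq0 two_neq0)
  (TPCA_compat H1 a1 b1 c1) (TPCA_compat_swap H1 a1 b1 c1)
  (TPCA_compat_bracket H1 a1 b1 c1)
  (TPCA_compat H2 a2 b2 c2) (TPCA_compat_swap H2 a2 b2 c2)
  (TPCA_compat_bracket H2 a2 b2 c2)
  (TPCA_assoc H1 a1 b1 c1) (TPCA_assoc_swap H1 a1 b1 c1)
  (TPCA_assoc H2 a2 b2 c2) (TPCA_assoc_swap H2 a2 b2 c2)
  (TPCA_Jacobi H1 a1 b1 c1) (TPCA_Jacobi H2 a2 b2 c2)).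
Qed.

Lemma tensor_TPCA : (2 : K) != 0 -> TPCA circ brk.
Proof.
move=> two_neq0.
have circC := tensor_product_conformal (TPCA_circ_conformal H1) circB circT.
have brkC := conformal_add
  (tensor_product_conformal (TPCA_brk_conformal H1) brklB brklT)
  (tensor_product_conformal (TPCA_circ_conformal H1) brkrB brkrT).
split; first by split; [exact: circC | exact: tensor_assoc | exact: tensor_comm].
  split; [exact: brkC | exact: tensor_skew |].
  by move=> a b c; apply: tensor_Jacobi.
exact: tensor_compat.
Qed.
End Structure.
End Assembly.

Lemma tensor_product_unique (K : fieldType) (M N : lmodType {poly K})
    (G : M -> M -> N -> N -> poly1 (M ⊗[{poly K}] N))
    (f : M ⊗[{poly K}] N -> M ⊗[{poly K}] N -> poly1 (M ⊗[{poly K}] N)) :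
  Kbilinear f -> (forall a1 b1 a2 b2, f (a1 ⊗ a2) (b1 ⊗ b2) = G a1 b1 a2 b2) ->
  unique (fun f => Kbilinear f /\
    forall a1 b1 a2 b2, f (a1 ⊗ a2) (b1 ⊗ b2) = G a1 b1 a2 b2) f.
Proof.
move=> fK fG; split=> // f' [f'K f'G]; apply/funext => a; apply/funext => b.
apply: (tensor_ext2 (Kbilinear_biadditive fK) (Kbilinear_biadditive f'K)).
by move=> a1 a2 b1 b2; rewrite fG f'G.
Qed.

Theorem theorem3p6 (R : realType) (L1 L2 : lmodType {poly R[i]})
    (circ1 brk1 : L1 -> L1 -> poly1 L1) (circ2 brk2 : L2 -> L2 -> poly1 L2) :
  TPCA circ1 brk1 -> TPCA circ2 brk2 ->
  let L : lmodType {poly R[i]} := (L1 ⊗[{poly R[i]}] L2)%type in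
  exists circ brk : L -> L -> poly1 L,
    [/\ unique (fun f : L -> L -> poly1 L => Kbilinear f /\
          forall a1 b1 a2 b2,
            f (a1 ⊗ a2) (b1 ⊗ b2) = tens_poly (circ1 a1 b1) (circ2 a2 b2)) circ,
        unique (fun f : L -> L -> poly1 L => Kbilinear f /\
          forall a1 b1 a2 b2,
            f (a1 ⊗ a2) (b1 ⊗ b2) =
              tens_poly (brk1 a1 b1) (circ2 a2 b2) +
              tens_poly (circ1 a1 b1) (brk2 a2 b2)) brk &
        TPCA circ brk].
Proof.
move=> H1 H2 L.
have circ1C := TPCA_circ_conformal H1; have brk1C := TPCA_brk_conformal H1.
have circ2C := TPCA_circ_conformal H2; have brk2C := TPCA_brk_conformal H2.
have [circ circB circT] := tensor_product_exists circ1C circ2C.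
have [brkl brklB brklT] := tensor_product_exists brk1C circ2C.
have [brkr brkrB brkrT] := tensor_product_exists circ1C brk2C.
have two_neq0 : (2 : R[i]) != 0 by rewrite Num.Theory.pnatr_eq0.
have H := tensor_TPCA H1 H2 circB brklB brkrB circT brklT brkrT two_neq0.
have [[[circK _ _] _ _] [[brkK _ _] _ _] _] := H.
exists circ, (brk_sum brkl brkr); split; last exact: H.
- exact: (tensor_product_unique
    (G := fun a1 b1 a2 b2 => tens_poly (circ1 a1 b1) (circ2 a2 b2)) circK circT).
- apply: (tensor_product_unique (G := fun a1 b1 a2 b2 =>
    tens_poly (brk1 a1 b1) (circ2 a2 b2) + tens_poly (circ1 a1 b1) (brk2 a2 b2))
    brkK) => a1 b1 a2 b2.
  by rewrite /brk_sum brklT brkrT.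
Qed.
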